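(* Let $\{(m_S,v_S^2): S\subseteq\{1,\dots,N\}\}$ be the second-order channel model, and let real numbers $\mu_i,\sigma_i^2$ ($1\le i\le N$) satisfy $$\sum_{i\in S}\mu_i< m_S\ \text{ for all nonempty } S\subsetneq\{1,\dots,N\},\qquad \sum_{i=1}^N\mu_i=m_{\{1,2,\dots,N\}},$$ $$\sum_{i=1}^N\sqrt{\sigma_i^2}\ \ge\ \sqrt{v_{\{1,2,\dots,N\}}^2},\qquad \mu_i\ge 0,\ \sigma_i^2>0\ \text{ for all } i.$$ Then, under the variance-weighted-deficit (VWD) policy with parameters $\{(\mu_i,\sigma_i^2)\}$, for all $i$, $$\lim_{T\to\infty}\frac{\sum_{t=1}^TZ_i(t)}{T}=\mu_i\qquad\text{and}\qquad E\Big[\Big(\lim_{T\to\infty}\frac{\sum_{t=1}^TZ_i(t)-T\mu_i}{\sqrt T}\Big)^2\Big]\le\sigma_i^2 .$$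
   Context: An access point (AP) serves $N$ clients $1,\dots,N$ in slotted time $t=1,2,3,\dots$. Let $X_i(t)\in\{0,1\}$ indicate that the channel of client $i$ is ON at time $t$. The channels are governed by Markov processes: the vector $(X_1(t),\dots,X_N(t))$ is a function of the state of an irreducible, positive-recurrent, finite-state Markov chain whose evolution is not affected by scheduling decisions. For $S\subseteq\{1,\dots,N\}$, $X_S(t):=\max\{X_i(t): i\in S\}$ (with $X_\emptyset\equiv 0$). The mean is $m_S:=\lim_{T\to\infty}\frac1T\sum_{t=1}^TX_S(t)$ (almost sure limit, a constant), and the temporal variance is $v_S^2:=E\big[\big(\lim_{T\to\infty}\frac{\sum_{t=1}^TX_S(t)-Tm_S}{\sqrt T}\big)^2\big]$, where the limit is in distribution (it exists and is Gaussian, possibly degenerate), i.e. $v_S^2$ is the second moment of the limiting law. The collection $\{(m_S,v_S^2)\}$ is the second-order channel model. In each slot $t$ in which at least one client has an ON channel, the AP selects exactly one client with an ON channel and transmits a packet to it, which that client receives; if no channel is ON nothing is transmitted. $Z_i(t)\in\{0,1\}$ indicates that client $i$ receives a packet at time $t$. VWD policy: given $\{(\mu_i,\sigma_i^2)\}$, the deficit of client $i$ at time $t$ is $d_i(t)=t\mu_i-\sum_{\tau=1}^tZ_i(\tau)$ (with $d_i(0)=0$). In each slot $t$, among the clients with ON channels, the AP chooses the one with the largest $d_i(t-1)/\sqrt{\sigma_i^2}$ (ties broken by a fixed deterministic rule, e.g. smallest index) and transmits a packet to it. In the conclusion, the first limit is almost sure, and the limit inside the expectation is a limit in distribution (whose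 existence is part of the assertion), so that expectation is the second moment of the limiting law. *)

(* Defs.v *)
(* MathComp / MathComp-Analysis *)
From HB Require Import structures.
From mathcomp Require Export all_boot all_order all_algebra.
From mathcomp Require Export all_classical all_reals all_analysis.
Export Order.TTheory GRing.Theory Num.Theory numFieldNormedType.Exports.

Global Set Implicit Arguments.
Global Unset Strict Implicit.
Global Unset Printing Implicit Defensive.

Global Open Scope ring_scope.

Definition stochastic (R : realType) (k : nat) (K : 'M[R]_k) : Prop :=
  (forall x y, 0 <= K x y) /\ (forall x, \sum_y K x y = 1).

Definition irreducible_chain (R : realType) (k : nat) (K : 'M[R]_k.+1) : Prop :=
  forall x y, exists n, 0 < (K ^+ n) x y.

(* [first_passage K n x y] is the probability, starting from [x], that the first
   visit to [y] at a positive time happens at time [n.+1]. *)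
Fixpoint first_passage (R : realType) (k : nat) (K : 'M[R]_k) (n : nat)
    (x y : 'I_k) : R :=
  if n is n'.+1 then \sum_(z | z != y) K x z * first_passage K n' z y
  else K x y.

Definition positive_recurrent (R : realType) (k : nat) (K : 'M[R]_k) : Prop :=
  forall x,
    (\sum_(0 <= n <oo) (first_passage K n x x)%:E = 1)%E /\
    (\sum_(0 <= n <oo) (n.+1%:R * first_passage K n x x)%:E < +oo)%E.

(* Time starts at slot 1. The Markov property is written with joint
   probabilities, so that null histories need no separate treatment; the law of
   [xi 1] is arbitrary. *)
Definition markov_chain d (T : measurableType d) (R : realType)
    (P : probability T R) (k : nat) (K : 'M[R]_k) (xi : nat -> T -> 'I_k) :
    Prop :=
  (forall t x, (0 < t)%N -> measurable [set w | xi t w = x]%classic) /\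
  (forall (t : nat) (s : nat -> 'I_k), (0 < t)%N ->
     P [set w | forall u, (0 < u <= t.+1)%N -> xi u w = s u]%classic =
     (P [set w | forall u, (0 < u <= t)%N -> xi u w = s u]%classic
      * (K (s t) (s t.+1))%:E)%E).

Definition markov_channels d (T : measurableType d) (R : realType)
    (P : probability T R) (N : nat) (X : 'I_N -> nat -> T -> bool) : Prop :=
  exists (k : nat) (K : 'M[R]_k.+1) (xi : nat -> T -> 'I_k.+1)
         (g : 'I_k.+1 -> 'I_N -> bool),
    [/\ stochastic K, irreducible_chain K, positive_recurrent K,
        markov_chain P K xi &
        forall i t w, (0 < t)%N -> X i t w = g (xi t w) i].

(* On booleans (0/1 values) the maximum is the disjunction, and the maximum over
   the empty set is [false]. *)
Definition subset_channel (T : Type) (N : nat) (X : 'I_N -> nat -> T -> bool)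
    (S : {set 'I_N}) (t : nat) (w : T) : bool :=
  \big[orb/false]_(i in S) X i t w.

Definition time_average (T : Type) (R : realType) (Y : nat -> T -> bool)
    (n : nat) (w : T) : R :=
  (\sum_(1 <= t < n.+1) (Y t w)%:R) / n%:R.

Definition scaled_deviation (T : Type) (R : realType) (Y : nat -> T -> bool)
    (a : R) (n : nat) (w : T) : R :=
  (\sum_(1 <= t < n.+1) (Y t w)%:R - n%:R * a) / Num.sqrt n%:R.

Definition cvg_as d (T : measurableType d) (R : realType) (P : probability T R)
    (Y : nat -> T -> R) (a : R) : Prop :=
  {ae P, forall w, (Y n w @[n --> \oo] --> a)%classic}.

Definition cvg_in_law d (T : measurableType d) (R : realType)
    (P : probability T R) (Y : nat -> T -> R)
    (L : probability (measurableTypeR R) R) : Prop :=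
  (forall n, measurable_fun [set: T]%classic (Y n)) /\
  (forall f : R -> R, continuous f -> (exists M : R, forall x, `|f x| <= M) ->
     ('E_P[fun w => (f (Y n w))%R]%E @[n --> \oo] --> 'E_L[f]%E)%classic).

(* [m S] and [v2 S] are the mean and the temporal variance of the maximum of the
   channels in [S]. *)
Definition second_order_model d (T : measurableType d) (R : realType)
    (P : probability T R) (N : nat) (X : 'I_N -> nat -> T -> bool)
    (m v2 : {set 'I_N} -> R) : Prop :=
  forall S : {set 'I_N},
    cvg_as P (time_average R (subset_channel X S)) (m S) /\
    exists L : probability (measurableTypeR R) R,
      cvg_in_law P (scaled_deviation (subset_channel X S) (m S)) L /\
      ('E_L[fun x => (x ^+ 2)%R] = (v2 S)%:E)%E.

Definition deficit (T : Type) (R : realType) (N : nat)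
    (Z : 'I_N -> nat -> T -> bool) (mu : 'I_N -> R) (t : nat) (w : T)
    (i : 'I_N) : R :=
  t%:R * mu i - \sum_(1 <= u < t.+1) (Z i u w)%:R.

Definition on_clients (T : Type) (N : nat) (X : 'I_N -> nat -> T -> bool)
    (t : nat) (w : T) : {set 'I_N} :=
  finset (fun i => X i t w).

Definition largest_ratio (R : realType) (N : nat) (sigma2 d : 'I_N -> R)
    (A : {set 'I_N}) : {set 'I_N} :=
  finset (fun i => (i \in A) &&
    [forall j in A, d j / Num.sqrt (sigma2 j) <= d i / Num.sqrt (sigma2 i)]).

(* A tie-breaking rule chooses an element of every nonempty set of clients; its
   value on the empty set is irrelevant. *)
Definition tie_breaking (N : nat) (tie : {set 'I_N} -> 'I_N) : Prop :=
  forall A : {set 'I_N}, A != finset.set0 -> tie A \in A.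

(* [Z i t] tells whether client [i] receives a packet in slot [t]. *)
Definition vwd_policy (T : Type) (R : realType) (N : nat)
    (tie : {set 'I_N} -> 'I_N) (mu sigma2 : 'I_N -> R)
    (X Z : 'I_N -> nat -> T -> bool) : Prop :=
  forall (t : nat) (w : T) (i : 'I_N), (0 < t)%N ->
    Z i t w = (on_clients X t w != finset.set0) &&
      (i == tie (largest_ratio sigma2 (deficit Z mu t.-1 w)
                   (on_clients X t w))).

(* Main.v *)
From HB Require Import structures.
Require Import Defs.
From mathcomp Require Import ring lra measurable_realfun.

(** Dividing the deficits by [sqrt (sigma2 i)] and subtracting their common weighted
    mean gives the imbalances [e i]. The policy serves an ON client with the largest
    [e i], so the quadratic form [V = \sum_i sqrt (sigma2 i) * e i ^ 2] has, up to
    bounded terms, increment [2 * (\sum_i e i * mu i - max_{i ON} e i)] in one slot.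
    Correcting [V] by the solution of the Poisson equation of the channel chain
    replaces the maximum by its stationary mean, and the capacity conditions make the
    drift at most [- b * sqrt V + c]. The square of the corrected function then has
    bounded drift, whence [E (e i (n)) ^ 4 = O(n)]: the imbalances are [o(sqrt n)] in
    probability and, by Borel-Cantelli, [o(n)] almost surely. So the deficit of client
    [i] is asymptotically the fraction [sqrt (sigma2 i) / \sum_j sqrt (sigma2 j)] of
    the total deficit, which does not depend on the policy and is the centred sum of
    the maximum of all channels; the variance bound is then the hypothesis on the
    [sigma2 i]. *)

(** * The Poisson equation *)

Lemma stochastic_exp (R : realType) (k : nat) (K : 'M[R]_k.+1) n :
  stochastic K -> stochastic (K ^+ n).
Proof.
move=> [K0 K1]; elim: n => [|n [IH0 IH1]].
  split=> [x y|x]; first by rewrite expr0 mxE; case: eqP.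
  rewrite (bigD1 x) //= expr0 mxE eqxx big1 ?addr0 // => y yx.
  by rewrite mxE eq_sym (negbTE yx).
split=> [x y|x]; first by rewrite exprS mxE sumr_ge0 // => z _; rewrite mulr_ge0.
under eq_bigr do rewrite exprS mxE.
rewrite exchange_big /= -[RHS](K1 x); apply: eq_bigr => z _.
by rewrite -mulr_sumr IH1 mulr1.
Qed.

Lemma exists_argmax (R : realType) (k : nat) (f : 'I_k.+1 -> R) :
  exists x, forall y, f y <= f x.
Proof.
by exists [arg max_(i > ord0) f i]%O; case: arg_maxP => // i _ H y; exact: H.
Qed.

Lemma stochastic_avg_le (R : realType) (k : nat) (K : 'M[R]_k) (f : 'I_k -> R) x b :
  stochastic K -> (forall y, f y <= b) -> \sum_y K x y * f y <= b.
Proof.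
move=> [K0 K1] fb; rewrite -[b]mul1r -(K1 x) mulr_suml; apply: ler_sum => y _.
exact: ler_wpM2l.
Qed.

(** Maximum principle: [f - K f] is nonnegative where [f] is maximal and nonpositive where it is
    minimal, so [c = 0] and [f] is invariant under every power of [K]. At a maximiser the
    nonnegative terms [K^n * (max f - f)] then sum to zero, and irreducibility makes the weight of
    any given state positive for some [n]. *)
Lemma harmonic_const (R : realType) (k : nat) (K : 'M[R]_k.+1)
    (f : 'I_k.+1 -> R) (c : R) :
  stochastic K -> irreducible_chain K ->
  (forall x, f x - \sum_y K x y * f y = c) ->
  c = 0 /\ forall x y, f x = f y.
Proof.
move=> Ks Ki fK.
have [xM HM] := exists_argmax f.
have [xm Hm] := exists_argmax (fun x => - f x).
have c0 : c = 0.
  apply/eqP; rewrite eq_le; apply/andP; split.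
    rewrite -(fK xm) subr_le0 -lerN2 -sumrN.
    by under eq_bigr do rewrite -mulrN; exact: (stochastic_avg_le (f := fun y => - f y)).
  by rewrite -(fK xM) subr_ge0; exact: stochastic_avg_le.
split=> //.
have Kn n x : \sum_y (K ^+ n) x y * f y = f x.
  elim: n x => [|n IH] x.
    rewrite expr0 (bigD1 x) //= mxE eqxx mul1r big1 ?addr0 // => y yx.
    by rewrite mxE eq_sym (negbTE yx) mul0r.
  under eq_bigr do rewrite exprS mxE mulr_suml.
  rewrite exchange_big /=.
  have : f x = \sum_y K x y * f y by apply/eqP; rewrite -subr_eq0 fK c0.
  move=> ->; apply: eq_bigr => z _; rewrite -IH mulr_sumr.
  by apply: eq_bigr => y _; rewrite mulrA.
suff H x : f x = f xM by move=> x y; rewrite !H.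
apply/eqP; rewrite eq_le HM /=.
have [n Hn] := Ki xM x; have [Kn0 Kn1] := stochastic_exp n Ks.
have : \sum_y (K ^+ n) xM y * (f xM - f y) = 0.
  under eq_bigr do rewrite mulrBr.
  by rewrite sumrB Kn -mulr_suml Kn1 mul1r subrr.
move/psumr_eq0P => /(_ _ x isT) H.
have {}H : (K ^+ n) xM x * (f xM - f x) = 0.
  by apply: H => i _; rewrite mulr_ge0 // subr_ge0.
move/eqP: H; rewrite mulf_eq0 gt_eqF //= subr_eq0 => /eqP ->; exact: lexx.
Qed.

(* The matrix [1 - K + e], with [e] the matrix whose first column is constant [1],
   is invertible; its inverse solves the Poisson equation. *)
Lemma poisson_equation (R : realType) (k : nat) (K : 'M[R]_k.+1) :
  stochastic K -> irreducible_chain K ->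
  exists Q : 'M[R]_k.+1, forall (g : 'I_k.+1 -> R) x,
    let f z := \sum_y Q z y * g y in
    f x - \sum_y K x y * f y = g x - f ord0.
Proof.
move=> Ks Ki; pose e : 'M[R]_k.+1 := \matrix_(x, y) (y == ord0)%:R.
pose B : 'M[R]_k.+1 := 1 - K + e.
have Bf (f : 'I_k.+1 -> R) x :
    \sum_y B x y * f y = f x - \sum_y K x y * f y + f ord0.
  under eq_bigr do rewrite !mxE mulrDl mulrBl.
  rewrite big_split /= sumrB; congr (_ - _ + _).
    rewrite (bigD1 x) //= eqxx mul1r big1 ?addr0 // => y yx.
    by rewrite eq_sym (negbTE yx) mul0r.
  rewrite (bigD1 ord0) //= mul1r big1 ?addr0 // => y yx.
  by rewrite (negbTE yx) mul0r.
have Bu : B \in unitmx.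
  (* A kernel vector [v] of [B] satisfies [v - K v = - v ord0]. By [harmonic_const] this constant is
     zero and [v] is constant, hence [v = 0]. *)
  rewrite -unitmx_tr unitmxE unitfE; apply/negP => /det0P[v v0 vB].
  case/negP: v0; apply/eqP/rowP => y; rewrite mxE.
  have H x : v 0 x - \sum_y K x y * v 0 y = - v 0 ord0.
    apply/eqP; rewrite -subr_eq0 opprK -(Bf (fun y => v 0 y)).
    have /rowP/(_ x) := vB; rewrite [RHS]mxE => vB0; rewrite -[X in _ == X]vB0 mxE.
    by apply/eqP/eq_bigr => z _; rewrite [B^T _ _]mxE mulrC.
  have [h0 hc] := harmonic_const Ks Ki H.
  by rewrite (hc y ord0) -[v 0 ord0]opprK h0 oppr0.
exists (invmx B) => g x f; apply/eqP; rewrite -subr_eq0 opprB addrA subr_eq0.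
rewrite -Bf; apply/eqP.
under eq_bigr do rewrite mulr_sumr.
rewrite exchange_big /=.
have /matrixP BB := mulmxV Bu.
transitivity (\sum_z (1%:M : 'M[R]_k.+1) x z * g z).
  apply: eq_bigr => z _; rewrite -BB mxE mulr_suml.
  by apply: eq_bigr => y _; rewrite mulrA.
rewrite (bigD1 x) //= mxE eqxx mul1r big1 ?addr0 // => y yx.
by rewrite mxE eq_sym (negbTE yx) mul0r.
Qed.

(** * Histories of the chain *)

(** The latest state comes first, so that [head] is the current state and adding a slot is a [cons].
    Slot 0 is left out, since time starts at slot 1. *)
Fixpoint history (T : Type) (k : nat) (xi : nat -> T -> 'I_k) (n : nat) (w : T) :
    seq 'I_k :=
  if n is n'.+1 then xi n w :: history xi n' w else [::].

Lemma size_history (T : Type) (k : nat) (xi : nat -> T -> 'I_k) n w :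
  size (history xi n w) = n.
Proof. by elim: n => //= n ->. Qed.

Lemma nth_history (T : Type) (k : nat) (xi : nat -> T -> 'I_k.+1) n w u :
  (0 < u <= n)%N -> nth ord0 (history xi n w) (n - u) = xi u w.
Proof.
case/andP=> u0; elim: n => [|n IH] un; first by case: u u0 un.
case: (ltngtP u n.+1) un => // [un _|-> _]; last by rewrite subnn.
by rewrite subSn //= IH.
Qed.

Lemma history_eqE (T : Type) (k : nat) (xi : nat -> T -> 'I_k.+1) n w h :
  size h = n ->
  (history xi n w = h) <->
  (forall u, (0 < u <= n)%N -> xi u w = nth ord0 h (n - u)).
Proof.
move=> hn; split=> [<- u un|H]; first by rewrite nth_history.
apply: (@eq_from_nth _ ord0); rewrite size_history // => i ni.
have nin : (0 < n - i <= n)%N by rewrite subn_gt0 ni leq_subr.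
by rewrite -[in LHS](subKn (ltnW ni)) nth_history // H // subKn // ltnW.
Qed.

(* [path_expectation nu K n phi] is the mean of [phi] over the histories of
   length [n.+1] of the chain with initial law [nu]. *)
Fixpoint path_expectation (R : realType) (k : nat) (nu : 'I_k.+1 -> R)
    (K : 'M[R]_k.+1) (n : nat) (phi : seq 'I_k.+1 -> R) : R :=
  if n is n'.+1 then
    path_expectation nu K n'
      (fun h => \sum_y K (head ord0 h) y * phi (y :: h))
  else \sum_x nu x * phi [:: x].

(** * Expectations over finite paths *)

Section PathExpectation.
Variables (R : realType) (k : nat) (nu : 'I_k.+1 -> R) (K : 'M[R]_k.+1).
Hypotheses (nu0 : forall x, 0 <= nu x) (nu1 : \sum_x nu x = 1).
Hypothesis Ks : stochastic K.
Local Notation Ex := (path_expectation nu K).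

Lemma path_expectation_le n (phi psi : seq 'I_k.+1 -> R) :
  (forall h, size h = n.+1 -> phi h <= psi h) -> Ex n phi <= Ex n psi.
Proof.
have [K0 _] := Ks.
elim: n phi psi => [|n IH] phi psi H /=.
  by apply: ler_sum => x _; rewrite ler_wpM2l // H.
apply: IH => h hn; apply: ler_sum => y _; rewrite ler_wpM2l // H //=.
by rewrite hn.
Qed.

Lemma eq_path_expectation n (phi psi : seq 'I_k.+1 -> R) :
  (forall h, size h = n.+1 -> phi h = psi h) -> Ex n phi = Ex n psi.
Proof.
move=> H; apply/eqP; rewrite eq_le.
by rewrite !path_expectation_le // => h /H ->.
Qed.

Lemma path_expectation_affine n (phi : seq 'I_k.+1 -> R) a b :
  Ex n (fun h => a * phi h + b) = a * Ex n phi + b.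
Proof.
have [_ K1] := Ks.
elim: n phi => [|n IH] phi /=.
  under eq_bigr do rewrite mulrDr mulrCA.
  by rewrite big_split /= -mulr_sumr -mulr_suml nu1 mul1r.
rewrite -IH; apply: eq_path_expectation => h _.
under eq_bigr do rewrite mulrDr mulrCA.
by rewrite big_split /= -mulr_sumr -mulr_suml K1 mul1r.
Qed.

(** The [K]-average over the next state is the conditional mean given the history [h]; a bound on
    the conditional increment is summed over the slots. *)
Lemma path_expectation_drift (phi : seq 'I_k.+1 -> R) c n :
  (forall h, h != [::] -> \sum_y K (head ord0 h) y * phi (y :: h) <= phi h + c) ->
  Ex n phi <= Ex 0 phi + c *+ n.
Proof.
move=> H; elim: n => [|n IH]; first by rewrite mulr0n addr0.
rewrite mulrS addrCA [leRHS]addrC.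
apply: (@le_trans _ _ (Ex n (fun h => 1 * phi h + c))).
  by rewrite /=; apply: path_expectation_le => -[//|x h] _; rewrite mul1r H.
by rewrite path_expectation_affine mul1r lerD2r.
Qed.

(** The probability of a path listed from its latest state back to its first, which is drawn from
    [nu]. *)
Fixpoint path_weight (h : seq 'I_k.+1) : R :=
  match h with
  | [::] => 1
  | [:: x] => nu x
  | y :: ((x :: _) as h') => path_weight h' * K x y
  end.

Lemma path_expectationE n (phi : seq 'I_k.+1 -> R) :
  Ex n phi = \sum_(h : n.+1.-tuple 'I_k.+1) path_weight h * phi h.
Proof.
elim: n phi => [|n IH] phi /=.
  rewrite (reindex (fun x : 'I_k.+1 => [tuple x])) //=.
  exists (fun h : 1.-tuple _ => thead h) => h _ //=.
  by case: h => -[|x []] // hn; apply/val_inj; rewrite /= /thead (tnth_nth x).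
rewrite IH.
rewrite (reindex (fun p : 'I_k.+1 * n.+1.-tuple 'I_k.+1 => [tuple of p.1 :: p.2])) /=.
  rewrite -(pair_bigA _ (fun y (h : n.+1.-tuple 'I_k.+1) =>
     path_weight (y :: h) * phi (y :: h))) /= exchange_big.
  apply: eq_bigr => h _; rewrite mulr_sumr; apply: eq_bigr => y _.
  by case: h => -[|x h] hn //=; rewrite mulrA.
exists (fun h : n.+2.-tuple _ => (thead h, [tuple of behead h])) => [[y h] _|h _] /=.
  by congr pair; apply/val_inj.
by rewrite [RHS]tuple_eta.
Qed.

End PathExpectation.

(** * The law of the histories under the given probability *)

Section HistoryLaw.
Variables (d : measure_display) (T : measurableType d) (R : realType).
Variables (P : probability T R) (k : nat) (K : 'M[R]_k.+1).
Variable (xi : nat -> T -> 'I_k.+1).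
Hypotheses (Ks : stochastic K) (Hxi : markov_chain P K xi).

Definition initial_law (x : 'I_k.+1) : R := fine (P [set w | xi 1 w = x]%classic).

Lemma measurable_history_eq n h : measurable [set w | history xi n w = h]%classic.
Proof.
have [mxi _] := Hxi.
elim: n h => [|n IH] [|x h] /=.
- rewrite (_ : [set _ | _]%classic = setT) //.
  by apply/seteqP; split.
- rewrite (_ : [set _ | _]%classic = set0) //.
  by apply/seteqP; split.
- rewrite (_ : [set _ | _]%classic = set0) //.
  by apply/seteqP; split.
rewrite (_ : [set _ | _]%classic =
  ([set w | xi n.+1 w = x] `&` [set w | history xi n w = h])%classic).
  by apply: measurableI => //; exact: mxi.
by apply/seteqP; split => w /= [-> ->].
Qed.

Lemma history_bigcup n (Q : pred (seq 'I_k.+1)) :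
  [set w | Q (history xi n w)]%classic =
  (\bigcup_(h in [set h : n.-tuple 'I_k.+1 | Q h])
     [set w | history xi n w = h])%classic.
Proof.
apply/seteqP; split => w /=; last by case=> h /= Qh ->.
have hn : size (history xi n w) == n by rewrite size_history.
by move=> Qw; exists (Tuple hn).
Qed.

Lemma measurable_history n (Q : pred (seq 'I_k.+1)) :
  measurable [set w | Q (history xi n w)]%classic.
Proof.
rewrite history_bigcup; apply: fin_bigcup_measurable; first exact: finite_finset.
by move=> h _; exact: measurable_history_eq.
Qed.

(** There are only finitely many histories of a given length, so every function of the history is
    measurable. *)
Lemma measurable_fun_history n (f : seq 'I_k.+1 -> R) :
  measurable_fun [set: T]%classic (fun w => f (history xi n w)).
Proof.
move=> _ Y mY; rewrite setTI.
rewrite (_ : (_ @^-1` _)%classic =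
  [set w | (fun h => `[< Y (f h) >]) (history xi n w)]%classic).
  exact: (measurable_history n (fun h => `[< Y (f h) >])).
by apply/seteqP; split => w /=; [move=> ?; apply/asboolP|move/asboolP].
Qed.

Lemma initial_law_ge0 x : 0 <= initial_law x.
Proof. exact: fine_ge0. Qed.

Lemma history_weight n h : size h = n.+1 ->
  P [set w | history xi n.+1 w = h]%classic = (path_weight initial_law K h)%:E.
Proof.
have [_ PK] := Hxi.
elim: n h => [|n IH] h hn.
  case: h hn => [|x [|z h]] //= _.
  rewrite /initial_law fineK ?fin_num_measure //; last by have [mxi _] := Hxi; exact: mxi.
  by congr (P _); apply/seteqP; split => w /=; [case|move=> ->].
have E h' m : size h' = m.+1 -> forall s : nat -> 'I_k.+1,
    (forall u, (0 < u <= m.+1)%N -> s u = nth ord0 h' (m.+1 - u)) ->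
    [set w | history xi m.+1 w = h']%classic =
    [set w | forall u, (0 < u <= m.+1)%N -> xi u w = s u]%classic.
  move=> hm s Hs; apply/seteqP; split => w /=.
    by move/(history_eqE xi w hm) => H u un; rewrite H // Hs.
  by move=> H; apply/(history_eqE xi w hm) => u un; rewrite H // Hs.
case: h hn => [|y [|x h]] //= [hn].
(* The Markov property is stated for trajectories indexed by time; [s] reads the reversed list as
   such a trajectory. *)
pose s u := nth ord0 [:: y, x & h] (n.+2 - u).
have {}hn : size (x :: h) = n.+1 by rewrite /= hn.
rewrite (E _ _ _ s) //=; last by rewrite -hn.
rewrite PK // -(E (x :: h)) //.
  by rewrite IH // -EFinM /s subnn subSnn.
by move=> u /andP[_ un]; rewrite /s subSn.
Qed.

Lemma initial_law_sum1 : \sum_x initial_law x = 1.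
Proof.
have [mxi _] := Hxi.
apply/EFin_inj; rewrite -sumEFin -(probability_setT P).
rewrite (_ : setT = \bigcup_(x in [set: 'I_k.+1]) [set w | xi 1%N w = x])%classic.
  rewrite measure_fin_bigcup //; first last.
  - by move=> x _; exact: mxi.
  - by move=> x y _ _ [w [/= <- <-]].
  - exact: finite_finset.
  rewrite (fsbigE (enum 'I_k.+1)) ?enum_uniq //=.
    rewrite big_enum_cond /= [RHS]big_mkcond; apply: eq_bigr => x _.
    rewrite in_setT /initial_law fineK // fin_num_measure //; exact: mxi.
  by move=> x _; rewrite mem_enum.
by apply/seteqP; split => // w _; exists (xi 1%N w).
Qed.

Lemma probability_history n (Q : pred (seq 'I_k.+1)) :
  P [set w | Q (history xi n.+1 w)]%classic =
  (path_expectation initial_law K n (fun h => (Q h)%:R))%:E.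
Proof.
rewrite path_expectationE history_bigcup measure_fin_bigcup; first last.
- by move=> h _; exact: measurable_history_eq.
- by move=> g h _ _ [w [/= -> /val_inj]].
- exact: finite_finset.
pose r := seq.filter (fun h : n.+1.-tuple 'I_k.+1 => Q h) (enum {: n.+1.-tuple 'I_k.+1}).
rewrite (fsbigE r) /r; first last.
- by move=> h /= Qh; rewrite mem_filter mem_enum Qh.
- by move=> h /=; rewrite mem_filter => /andP[].
- by rewrite filter_uniq ?enum_uniq.
rewrite big_filter_cond big_enum_cond /= -sumEFin big_mkcond; apply: eq_bigr => h _.
rewrite mem_setE andbb history_weight ?size_tuple //.
by case: (Q h); rewrite ?mulr1 ?mulr0.
Qed.

(** Markov's inequality, read on path expectations: [a] times the indicator of [a <= phi] is at most
    [phi]. *)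
Lemma history_markov n (phi : seq 'I_k.+1 -> R) a :
  (forall h, 0 <= phi h) -> 0 < a ->
  (P [set w | a <= phi (history xi n.+1 w)]%R%classic <=
   (path_expectation initial_law K n phi / a)%:E)%E.
Proof.
move=> phi0 a0.
rewrite (probability_history n (fun h => a <= phi h)) lee_fin ler_pdivlMr //.
rewrite mulrC -[leLHS]addr0 -(path_expectation_affine initial_law_ge0 initial_law_sum1 Ks).
apply: path_expectation_le => // [|h _]; first exact: initial_law_ge0.
rewrite addr0; case: (leP a) => [|_]; first by rewrite mulr1.
by rewrite mulr0.
Qed.

End HistoryLaw.

(** * Lyapunov drift of the imbalances *)

(** The value 0 on the empty set is the right one: with no ON channel nobody is served and the drift
    has no service term. *)
Definition max_on (R : realType) (N : nat) (e : 'I_N -> R) (A : {set 'I_N}) : R :=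
  if [pick i in A | [forall j in A, e j <= e i]] is Some i then e i else 0.

Lemma max_onE (R : realType) (N : nat) (e : 'I_N -> R) (A : {set 'I_N}) i :
  i \in A -> (forall j, j \in A -> e j <= e i) -> max_on e A = e i.
Proof.
move=> iA H; rewrite /max_on; case: pickP => [l /andP[lA /forall_inP Hl]|/(_ i)].
  by apply/eqP; rewrite eq_le H // Hl.
by rewrite iA /= => /negP[]; apply/forall_inP.
Qed.

Lemma max_on0 (R : realType) (N : nat) (e : 'I_N -> R) : max_on e finset.set0 = 0.
Proof. by rewrite /max_on; case: pickP => // i; rewrite inE. Qed.

Lemma max_on_witness (R : realType) (N : nat) (e : 'I_N -> R) (A : {set 'I_N}) :
  A != finset.set0 -> exists2 i, i \in A & forall j, j \in A -> e j <= e i.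
Proof.
case/set0Pn=> i0 i0A; exists [arg max_(i > i0 in A) e i]%O.
  by case: arg_maxP.
by case: arg_maxP => // i _ H j; exact: H.
Qed.

Lemma max_on_lipschitz (R : realType) (N : nat) (e f : 'I_N -> R) A b :
  0 <= b -> (forall i, `|e i - f i| <= b) -> `|max_on e A - max_on f A| <= b.
Proof.
move=> b0 ef; have [->|A0] := eqVneq A finset.set0.
  by rewrite !max_on0 subrr normr0.
have [i iA Hi] := max_on_witness e A0; have [j jA Hj] := max_on_witness f A0.
rewrite (max_onE iA Hi) (max_onE jA Hj).
move: (Hi _ jA) (Hj _ iA) (ef i) (ef j); rewrite !ler_norml.
by move=> ? ? /andP[? ?] /andP[? ?]; apply/andP; split; lra.
Qed.

(* Replacing the maximal value of [e] by the next one lowers both sides by a multiple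
   of the capacity condition for the set where [e] is maximal, as in the layer-cake
   formula for the Choquet integral. *)
Lemma max_weight_drift (R : realType) (N k : nat) (mu : 'I_N -> R)
    (ON : 'I_k -> {set 'I_N}) (l : 'I_k -> R) (delta : R) :
  0 <= delta ->
  (forall S : {set 'I_N}, S != finset.set0 -> S != [set: 'I_N]%SET ->
     \sum_(i in S) mu i + delta <= \sum_x l x * (S :&: ON x != finset.set0)%:R) ->
  \sum_i mu i = \sum_x l x * ([set: 'I_N]%SET :&: ON x != finset.set0)%:R ->
  forall (e : 'I_N -> R) i j,
    \sum_a e a * mu a + delta * (e i - e j) <= \sum_x l x * max_on e (ON x).
Proof.
move=> d0 HS HT e.
pose am (e : 'I_N -> R) := [set i | [forall j, e j <= e i]]%SET.
(* Induction on the number of clients at which [e] is not maximal. *)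
have [n] := ubnP #|~: am e|.
elim: n e => // n IH e; rewrite ltnS => en i j.
have amP (f : 'I_N -> R) a : reflect (forall b, f b <= f a) (a \in am f).
  by rewrite inE; exact: forallP.
have [a aA] : exists a, a \in am e.
  exists [arg max_(a > i) e a]%O; apply/amP => b.
  by case: arg_maxP => // c _; apply.
have eA b : b \in am e -> e b = e a.
  by move=> bA; apply/eqP; rewrite eq_le !(amP _ _ _) //; apply/andP; split;
     apply/amP.
(* If [e] is constant the spread vanishes, and the equality for the full set gives equality of both
   sides. *)
have [AT|AT] := eqVneq (am e) [set: 'I_N]%SET.
  have ec b : e b = e a by apply: eA; rewrite AT inE.
  rewrite (ec i) (ec j) subrr mulr0 addr0.
  under eq_bigr do rewrite ec.
  rewrite -mulr_sumr HT mulr_sumr le_eqVlt; apply/orP; left; apply/eqP.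
  apply: eq_bigr => x _; rewrite mulrCA finset.setTI; congr (_ * _).
  have [->|X0] := eqVneq (ON x) finset.set0; first by rewrite max_on0 mulr0.
  have [b bX Hb] := max_on_witness e X0.
  by rewrite (max_onE bX Hb) ec mulr1.
have AC0 : ~: am e != finset.set0.
  by apply: contra_neq AT => E; rewrite -[am e]finset.setCK E finset.setC0.
have [c cA Hc] := max_on_witness e AC0.
(* [e'] lowers the top level to the second largest value [e c]; the client [c] then becomes maximal
   too, so the induction hypothesis applies. *)
pose e' b := if b \in am e then e c else e b.
have Me b : e b <= e a by apply/amP.
have Me' b : e' b <= e c.
  by rewrite /e'; case: ifP => // bA; rewrite Hc // inE bA.
have ne : (#|~: am e'| < n)%N.
  apply: leq_trans en; apply: proper_card; apply/properP; split.
    apply/fintype.subsetP => b; rewrite !inE; apply: contra => bA.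
    have bA' : b \in am e by rewrite inE.
    by apply/forallP => b'; rewrite (le_trans (Me' b')) // /e' bA'.
  exists c => //; rewrite finset.in_setC negbK; apply/amP => b.
  by rewrite (le_trans (Me' b)) // /e'; case: ifP.
have := IH _ ne i j.
have A0 : am e != finset.set0 by apply/set0Pn; exists a.
have := HS _ A0 AT.
have -> : \sum_b e b * mu b = \sum_b e' b * mu b + (e a - e c) * \sum_(b in am e) mu b.
  rewrite mulr_sumr big_mkcond [in X in _ + X]big_mkcond -big_split /=.
  apply: eq_bigr => b _; rewrite /e'; case: ifP => [/eA ->|_]; ring.
(* The maximum over [ON x] drops by [e a - e c] exactly when [ON x] meets the top level. *)
have -> : \sum_x l x * max_on e (ON x) = \sum_x l x * max_on e' (ON x) +
   (e a - e c) * \sum_x l x * (am e :&: ON x != finset.set0)%:R.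
  rewrite mulr_sumr -big_split /=; apply: eq_bigr => x _.
  rewrite mulrCA -mulrDr; congr (_ * _).
  have [X0|/set0Pn[b]] := eqVneq (am e :&: ON x) finset.set0; last first.
    rewrite inE => /andP[bA bX].
    rewrite (max_onE bX) => [|b' _]; last exact/amP.
    rewrite (@max_onE _ _ e' _ b) // => [|b' _]; last by rewrite {2}/e' bA.
    by rewrite (eA _ bA) /e' bA /=; ring.
  rewrite /= mulr0 addr0.
  have [->|Y0] := eqVneq (ON x) finset.set0; first by rewrite !max_on0.
  have [b bX Hb] := max_on_witness e Y0.
  have e'E b' : b' \in ON x -> e' b' = e b'.
    rewrite /e' => b'X; case: ifP => // b'A.
    by have := finset.in_set0 b'; rewrite -X0 finset.in_setI b'A b'X.
  rewrite (max_onE bX Hb) (@max_onE _ _ e' _ b) ?e'E //.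
  by move=> b' b'X; rewrite !e'E // Hb.
set s1 := \sum_(b in _) _; set s2 := \sum_x l x * (_)%:R.
set s3 := \sum_b _; set s4 := \sum_x _ => H1 H2.
have eac : 0 <= e a - e c by rewrite subr_ge0.
(* Lowering the top level reduces the spread by at most [e a - e c], which the slack [delta] in the
   capacity condition pays for. *)
have : delta * (e i - e j) <= delta * (e' i - e' j) + (e a - e c) * delta.
  rewrite (mulrC (e a - e c)) -mulrDr ler_wpM2l // /e'.
  move: (Me i).
  by case: ifP => [/eA ->|_]; case: ifP => [/eA ->|_] => *; lra.
have := ler_wpM2l eac H1; rewrite mulrDr; lra.
Qed.

(** Beyond [M] one has [b * r >= a2 + a1] and [r >= 1], so the cubic term absorbs the quadratic and
    linear ones; below [M] these are at most their values at [M]. *)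
Lemma cubic_bounded (R : realType) (a2 a1 a0 b : R) :
  0 <= a2 -> 0 <= a1 -> 0 < b ->
  exists C, forall r, 0 <= r -> a2 * r ^+ 2 + a1 * r + a0 - b * r ^+ 3 <= C.
Proof.
move=> a20 a10 b0; pose M := 1 + (a2 + a1) / b.
have M1 : 1 <= M by rewrite lerDl divr_ge0 ?addr_ge0 // ltW.
exists (a2 * M ^+ 2 + a1 * M + a0) => r r0.
have [rM|Mr] := leP r M.
  have h3 : 0 <= b * r ^+ 3 by rewrite mulr_ge0 ?exprn_ge0 // ltW.
  have h1 : a1 * r <= a1 * M by rewrite ler_wpM2l.
  have h2 : a2 * r ^+ 2 <= a2 * M ^+ 2.
    by rewrite ler_wpM2l // lerXn2r ?nnegrE //; lra.
  lra.
have h1 : a2 + a1 <= b * r.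
  have : b * M <= b * r by rewrite ler_wpM2l // ltW.
  by rewrite /M mulrDr mulr1 mulrC divfK ?gt_eqF //; lra.
have h2 : (a2 + a1) * r ^+ 2 <= b * r * r ^+ 2 by rewrite ler_wpM2r ?sqr_ge0.
have h3 : a1 * r <= a1 * r ^+ 2.
  by rewrite ler_wpM2l // expr2 ler_peMr //; lra.
have h4 : 0 <= a2 * M ^+ 2 + a1 * M.
  by rewrite addr_ge0 // mulr_ge0 ?exprn_ge0 //; lra.
have -> : b * r ^+ 3 = b * r * r ^+ 2 by ring.
lra.
Qed.

(** With [W] close to [r ^ 2], a drift [- b * r] of [W] gives its square a drift of order [- r ^ 3],
    which beats the quadratic contribution of the squared increments. The shift by [a ^ 2] makes the
    squared quantity at least [3 / 4 * r ^ 2], because [r ^ 2 - a * r + a ^ 2 = 3 / 4 * r ^ 2 + (r /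
    2 - a) ^ 2]. *)
Lemma square_drift (R : realType) (a b c : R) : 0 <= a -> 0 < b -> 0 <= c ->
  exists C, 0 <= C /\ forall (k : nat) (p w : 'I_k -> R) (W r : R),
    (forall y, 0 <= p y) -> \sum_y p y = 1 -> 0 <= r ->
    `|W - r ^+ 2| <= a * r ->
    (forall y, `|w y - W| <= a * (r + 1)) ->
    \sum_y p y * (w y - W) <= c - b * r ->
    \sum_y p y * (w y + a ^+ 2) ^+ 2 <= (W + a ^+ 2) ^+ 2 + C.
Proof.
move=> a0 b0 c0.
have a2 := sqr_ge0 a.
(* These are the coefficients of [2 * c * (r ^ 2 + a * r + a ^ 2) + a ^ 2 * (r + 1) ^ 2 - 3 / 2 * b
   * r ^ 3]. *)
have [C HC] := @cubic_bounded R (2 * c + a ^+ 2) (2 * a * c + 2 * a ^+ 2)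
  (2 * a ^+ 2 * c + a ^+ 2) (3 / 2 * b) (ltac:(nra)) (ltac:(nra)) (ltac:(lra)).
exists (Num.max 0 C); split.
  by rewrite le_max lexx.
move=> k p w W r p0 p1 r0 HW Hw Hd.
have {}HC := le_trans (HC r r0) (_ : C <= Num.max 0 C).
rewrite le_max lexx orbT in HC; have {}HC := HC isT.
have -> : \sum_y p y * (w y + a ^+ 2) ^+ 2 = (W + a ^+ 2) ^+ 2 +
    2 * (W + a ^+ 2) * \sum_y p y * (w y - W) + \sum_y p y * (w y - W) ^+ 2.
  rewrite -[X in X + _ + _](mul1r ((W + a ^+ 2) ^+ 2)) -[X in X * _ + _ + _]p1.
  rewrite mulr_suml mulr_sumr -!big_split /=.
  by apply: eq_bigr => y _; ring.
have h2 : \sum_y p y * (w y - W) ^+ 2 <= (a * (r + 1)) ^+ 2.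
  rewrite -[leRHS]mul1r -[X in _ <= X * _]p1 mulr_suml; apply: ler_sum => y _.
  rewrite ler_wpM2l // -[leLHS]real_normK ?num_real // lerXn2r ?nnegrE //.
  by rewrite mulr_ge0 // addr_ge0.
rewrite -addrA lerD2l.
move: HW; rewrite ler_norml => /andP[HW1 HW2].
have Wlo : 3 / 4 * r ^+ 2 <= W + a ^+ 2 by have := sqr_ge0 (r / 2 - a); nra.
have Wpos : 0 <= W + a ^+ 2 by have := sqr_ge0 r; lra.
have h1 : 2 * (W + a ^+ 2) * \sum_y p y * (w y - W) <=
    2 * (W + a ^+ 2) * (c - b * r) by rewrite ler_wpM2l //; lra.
have h3 : (W + a ^+ 2) * c <= (r ^+ 2 + a * r + a ^+ 2) * c.
  by rewrite ler_wpM2r //; lra.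
have h4 : 3 / 4 * r ^+ 2 * (b * r) <= (W + a ^+ 2) * (b * r).
  by rewrite ler_wpM2r // mulr_ge0 // ltW.
apply: le_trans HC; move: h1 h2 h3 h4.
set X := \sum_y _; set Y := \sum_y _.
have -> : 2 * (W + a ^+ 2) * (c - b * r) =
  2 * ((W + a ^+ 2) * c) - 2 * ((W + a ^+ 2) * (b * r)) by ring.
have -> : 3 / 4 * r ^+ 2 * (b * r) = (3 / 2 * b * r ^+ 3) / 2 by field.
nra.
Qed.

(** * Dynamics of deficits and imbalances under the policy *)

Definition served (R : realType) (N : nat) (sigma2 : 'I_N -> R)
    (tie : {set 'I_N} -> 'I_N) (d : 'I_N -> R) (A : {set 'I_N}) (i : 'I_N) : bool :=
  (A != finset.set0) && (i == tie (largest_ratio sigma2 d A)).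

(** The policy is deterministic, so replaying it on the list of channel states expresses the
    deficits as a function of the history, to which path expectations apply. *)
Fixpoint history_deficit (R : realType) (N : nat) (S : Type) (mu sigma2 : 'I_N -> R)
    (tie : {set 'I_N} -> 'I_N) (ON : S -> {set 'I_N}) (h : seq S) (i : 'I_N) : R :=
  if h is x :: h' then
    let d := history_deficit mu sigma2 tie ON h' in
    d i + (mu i - (served sigma2 tie d (ON x) i)%:R)
  else 0.

(** The subtracted quotient is the mean of the ratios [d j / sqrt (sigma2 j)] with weights
    [sqrt (sigma2 j)]. It is common to all clients, so the order of the ratios is kept. *)
Definition imbalance (R : realType) (N : nat) (sigma2 d : 'I_N -> R) (i : 'I_N) : R :=
  d i / Num.sqrt (sigma2 i) - (\sum_j d j) / \sum_j Num.sqrt (sigma2 j).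

Section Drift.
Variables (R : realType) (N k : nat) (K Q : 'M[R]_k.+1).
Variables (ON : 'I_k.+1 -> {set 'I_N}) (mu sigma2 : 'I_N -> R).
Variables (tie : {set 'I_N} -> 'I_N) (delta : R) (i0 : 'I_N).
Hypotheses (Ks : stochastic K) (Hs0 : forall i, 0 < sigma2 i).
Hypotheses (Htie : tie_breaking tie) (delta0 : 0 < delta).
Hypothesis HQ : forall (g : 'I_k.+1 -> R) x, let f z := \sum_y Q z y * g y in
  f x - \sum_y K x y * f y = g x - f ord0.
Hypothesis Hdrift : forall (e : 'I_N -> R) i j,
  \sum_a e a * mu a + delta * (e i - e j) <=
  \sum_x Q ord0 x * max_on e (ON x).

Local Notation s i := (Num.sqrt (sigma2 i)).
Local Notation imb := (imbalance sigma2).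
Local Notation D := (history_deficit mu sigma2 tie ON).

Let s_gt0 i : 0 < s i. Proof. by rewrite sqrtr_gt0. Qed.
Let ss_gt0 : 0 < \sum_i s i.
Proof. by rewrite (bigD1 i0) //= ltr_pwDl // sumr_ge0 // => i _; exact: ltW. Qed.

(** [corr] solves the Poisson equation for [max_on e], and [q] is a Lipschitz constant of it in the
    sup norm of [e]. [kappa] and [lambda] compare single entries and the spread of [e] with the root
    of the energy; [c0] bounds the change of an imbalance in one slot. *)
Let energy (e : 'I_N -> R) : R := \sum_i s i * e i ^+ 2.
Let corr (e : 'I_N -> R) x : R := \sum_z Q x z * max_on e (ON z).
Let kappa : R := 1 + \sum_i (s i)^-1.
Let lambda : R := 1 + \sum_i s i.
Let q : R := \sum_x \sum_z `|Q x z|.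
Let c0 : R := \sum_i (`|mu i| + 1) / s i + (\sum_i (`|mu i| + 1)) / \sum_i s i.

Lemma imbalance_sum0 d : \sum_i s i * imb d i = 0.
Proof.
under eq_bigr do rewrite mulrBr mulrCA mulfV ?gt_eqF // mulr1.
by rewrite sumrB -mulr_suml mulrCA mulfV ?gt_eqF // mulr1 subrr.
Qed.

Lemma imbalanceD d d' i : imb (fun j => d j + d' j) i = imb d i + imb d' i.
Proof. by rewrite /imbalance big_split /= !mulrDl; ring. Qed.

(** The client with the largest ratio also has the largest imbalance, so at most one summand is
    nonzero and it is the maximum over the ON clients. *)
Lemma served_max d A :
  \sum_i imb d i * (served sigma2 tie d A i)%:R = max_on (imb d) A.
Proof.
have [->|A0] := eqVneq A finset.set0.
  by rewrite max_on0 big1 // => i _; rewrite /served eqxx mulr0.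
have L0 : largest_ratio sigma2 d A != finset.set0.
  have [i iA Hi] := max_on_witness (fun j => d j / s j) A0.
  by apply/set0Pn; exists i; rewrite inE iA; apply/forall_inP.
have := Htie L0; set i := tie _; rewrite inE => /andP[iA /forall_inP Hi].
rewrite (bigD1 i) //= big1 => [|j ji]; last first.
  by rewrite /served (negbTE ji) andbF mulr0.
rewrite /served A0 eqxx mulr1 addr0 (max_onE iA) // => j jA.
by rewrite lerD2r Hi.
Qed.

Let increment d A i : R := imb (fun j => mu j - (served sigma2 tie d A j)%:R) i.

Let c0_ge0 : 0 <= c0.
Proof.
by rewrite addr_ge0 // ?divr_ge0 // ?sumr_ge0 // => i _; rewrite ?divr_ge0 ?addr_ge0 // ltW.
Qed.

Lemma increment_bound d A i : `|increment d A i| <= c0.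
Proof.
have H j : `|mu j - (served sigma2 tie d A j)%:R| <= `|mu j| + 1.
  by rewrite (le_trans (ler_normB _ _)) // lerD2l; case: served; rewrite ?normr1 ?normr0.
rewrite /increment /imbalance (le_trans (ler_normB _ _)) // lerD //.
  rewrite normrM normfV (ger0_norm (ltW (s_gt0 i))).
  rewrite (bigD1 i) //= -[leLHS]addr0 lerD ?ler_wpM2r ?invr_ge0 ?(ltW (s_gt0 i)) //.
  by rewrite sumr_ge0 // => j _; rewrite divr_ge0 ?addr_ge0 // ltW.
rewrite normrM normfV (ger0_norm (ltW ss_gt0)) ler_wpM2r ?invr_ge0 ?(ltW ss_gt0) //.
by rewrite (le_trans (ler_norm_sum _ _ _)) // ler_sum.
Qed.

Lemma imbalance_cons x h i :
  imb (D (x :: h)) i = imb (D h) i + increment (D h) (ON x) i.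
Proof. exact: imbalanceD. Qed.

Lemma energy_ge0 e : 0 <= energy e.
Proof. by rewrite sumr_ge0 // => i _; rewrite mulr_ge0 ?sqr_ge0 ?ltW. Qed.

Let kappa_ge0 : 0 <= kappa.
Proof. by rewrite addr_ge0 // sumr_ge0 // => i _; rewrite invr_ge0 ltW. Qed.

Lemma imbalance_le_energy e i : `|e i| <= kappa * Num.sqrt (energy e).
Proof.
have k1 : 1 <= kappa by rewrite lerDl sumr_ge0 // => j _; rewrite invr_ge0 ltW.
rewrite -(@ler_pXn2r _ 2) ?nnegrE ?mulr_ge0 ?sqrtr_ge0 //.
rewrite exprMn sqr_sqrtr ?energy_ge0 // real_normK ?num_real //.
have ks : (s i)^-1 <= kappa.
  by rewrite /kappa (bigD1 i) //= addrCA lerDl addr_ge0 // sumr_ge0.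
have : (s i)^-1 * energy e <= kappa ^+ 2 * energy e.
  rewrite ler_wpM2r ?energy_ge0 // (le_trans ks) // expr2.
  by rewrite ler_peMr // (le_trans ler01).
apply: le_trans; rewrite /energy (bigD1 i) //= mulrDr mulrA mulVf ?gt_eqF // mul1r.
rewrite lerDl mulr_ge0 ?invr_ge0 ?(ltW (s_gt0 i)) // sumr_ge0 // => j _.
by rewrite mulr_ge0 ?sqr_ge0 ?ltW.
Qed.

(** A vanishing weighted sum forces the maximum to be nonnegative and the minimum nonpositive, so
    every [|e l|] is at most the spread. The energy is then at most [\sum_l s l] times the squared
    spread, and [\sum_l s l <= lambda ^ 2]. *)
Lemma spread_ge_energy e : \sum_i s i * e i = 0 ->
  exists i j, Num.sqrt (energy e) <= lambda * (e i - e j).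
Proof.
move=> e0.
have T0 : [set: 'I_N]%SET != finset.set0 by apply/set0Pn; exists i0; rewrite inE.
have [i _ Hi] := max_on_witness e T0; have [j _ Hj] := max_on_witness (fun i => - e i) T0.
exists i, j.
have ei : 0 <= e i.
  rewrite leNgt; apply/negP => lt0.
  have : \sum_l s l * e l <= \sum_l s l * e i.
    by apply: ler_sum => l _; rewrite ler_wpM2l ?Hi ?inE // ltW.
  by rewrite e0 -mulr_suml pmulr_rge0 // leNgt lt0.
have ej : e j <= 0.
  rewrite leNgt; apply/negP => gt0.
  have : \sum_l s l * e j <= \sum_l s l * e l.
    apply: ler_sum => l _; rewrite ler_wpM2l ?(ltW (s_gt0 l)) //.
    by rewrite -lerN2 Hj ?inE.
  by rewrite e0 -mulr_suml pmulr_rle0 // leNgt gt0.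
have l1 : 1 <= lambda by rewrite lerDl ltW.
rewrite -(@ler_pXn2r _ 2) ?nnegrE ?sqrtr_ge0 //; last first.
  by rewrite mulr_ge0 //; lra.
rewrite sqr_sqrtr ?energy_ge0 // exprMn.
apply: (@le_trans _ _ ((\sum_l s l) * (e i - e j) ^+ 2)).
  rewrite mulr_suml; apply: ler_sum => l _; rewrite ler_wpM2l ?(ltW (s_gt0 l)) //.
  have := Hi l (finset.in_setT _); have := Hj l (finset.in_setT _) => ? ?.
  rewrite -[leLHS]real_normK ?num_real // lerXn2r ?nnegrE //; first lra.
  by rewrite ler_norml; apply/andP; split; lra.
rewrite ler_wpM2r ?sqr_ge0 // expr2 (le_trans _ (ler_peMr _ l1)) //; last lra.
by rewrite lerDr.
Qed.

Let q_ge0 : 0 <= q.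
Proof. by rewrite sumr_ge0 // => x _; rewrite sumr_ge0. Qed.

Lemma corr_lipschitz e f b x : 0 <= b -> (forall i, `|e i - f i| <= b) ->
  `|corr e x - corr f x| <= q * b.
Proof.
move=> b0 ef; rewrite /corr -sumrB (le_trans (ler_norm_sum _ _ _)) //.
rewrite /q [X in _ <= X * _](bigD1 x) //= mulrDl -[leLHS]addr0 lerD //; last first.
  by rewrite mulr_ge0 // sumr_ge0 // => y _; rewrite sumr_ge0.
rewrite mulr_suml; apply: ler_sum => z _.
by rewrite -mulrBr normrM ler_wpM2l // max_on_lipschitz.
Qed.

Lemma corr_bound e b x : 0 <= b -> (forall i, `|e i| <= b) -> `|corr e x| <= q * b.
Proof.
move=> b0 eb.
have -> : corr e x = corr e x - corr (fun=> 0) x.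
  rewrite [X in _ - X]big1 ?subr0 // => z _.
  have [->|Z0] := eqVneq (ON z) finset.set0; first by rewrite max_on0 mulr0.
  have [i iA Hi] := max_on_witness (fun=> 0 : R) Z0.
  by rewrite (max_onE iA Hi) mulr0.
by apply: corr_lipschitz => // i; rewrite subr0.
Qed.

(** The state [x] of the current slot is paired with the deficits before that slot is served. The
    factor 2 matches the service term [- 2 * max_on] in the increment of the energy. *)
Let lyapunov h : R :=
  if h is x :: h' then energy (imb (D h')) - 2 * corr (imb (D h')) x else 0.

Lemma energy_cons x h :
  energy (imb (D (x :: h))) = energy (imb (D h)) +
    2 * (\sum_i imb (D h) i * mu i - max_on (imb (D h)) (ON x)) +
    energy (increment (D h) (ON x)).
Proof.
rewrite /energy -served_max -sumrB mulr_sumr.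
under eq_bigr do rewrite imbalance_cons.
have -> : \sum_i 2 * (imb (D h) i * mu i -
      imb (D h) i * (served sigma2 tie (D h) (ON x) i)%:R) =
    \sum_i 2 * (s i * imb (D h) i * increment (D h) (ON x) i).
  rewrite -!mulr_sumr; congr (_ * _).
  set z := served _ _ _ _; pose S := (\sum_j (mu j - (z j)%:R)) / \sum_j s j.
  have E i : s i * imb (D h) i * increment (D h) (ON x) i =
      imb (D h) i * mu i - imb (D h) i * (z i)%:R - s i * imb (D h) i * S.
    rewrite /increment [X in _ * X = _]/imbalance -/z -/S [LHS]mulrBr -[X in _ = X - _]mulrBr.
    congr (_ - _); rewrite [s i * _]mulrC -mulrA; congr (_ * _).
    by rewrite mulrCA mulfV ?mulr1 // gt_eqF.
  (* The common shift [S] of the increments drops out, because the imbalances have weighted sum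
     zero. *)
  under [RHS]eq_bigr do rewrite E.
  by rewrite [RHS]sumrB -[X in _ = _ - X]mulr_suml imbalance_sum0 mul0r subr0.
by rewrite -!big_split /=; apply: eq_bigr => i _; ring.
Qed.

(** The constants for [square_drift]: [a] dominates both the distance of [lyapunov] from
    [radius ^ 2] and its one-slot change, [b] is the slope of the drift, and [c] collects the
    squared increment and the change of [corr] caused by the new imbalances. *)
Let ss : R := \sum_i s i.
Let a : R := 6 * q * kappa + 2 * ss * kappa * c0 + ss * c0 ^+ 2 + 2 * q * c0.
Let b : R := 2 * delta / lambda.
Let c : R := ss * c0 ^+ 2 + 2 * (q * c0).
Let radius h : R := Num.sqrt (energy (imb (D h))).

Let ss_ge0 : 0 <= ss. Proof. exact: ltW. Qed.

Let a_parts : [/\ 0 <= q * kappa, 0 <= ss * kappa * c0, 0 <= ss * c0 ^+ 2 & 0 <= q * c0].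
Proof. by split; rewrite ?mulr_ge0 ?sqr_ge0. Qed.

Let radius_ge0 h : 0 <= radius h. Proof. exact: sqrtr_ge0. Qed.

Lemma corr_radius h x : `|corr (imb (D h)) x| <= q * (kappa * radius h).
Proof.
apply: corr_bound => [|i]; first by rewrite mulr_ge0.
exact: imbalance_le_energy.
Qed.

Lemma lyapunov_size x h : `|lyapunov (x :: h) - radius h ^+ 2| <= a * radius h.
Proof.
have [a1 a2 a3 a4] := a_parts; have r0 := radius_ge0 h.
rewrite /= {1}/radius sqr_sqrtr ?energy_ge0 // addrAC subrr sub0r normrN normrM.
rewrite ger0_norm //; have := corr_radius h x; rewrite mulrA => H.
have : 0 <= (a - 2 * (q * kappa)) * radius h by rewrite mulr_ge0 // /a; lra.
by rewrite mulrBl; lra.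
Qed.

Lemma energy_increment_le h x : energy (increment (D h) (ON x)) <= ss * c0 ^+ 2.
Proof.
rewrite /energy /ss mulr_suml; apply: ler_sum => i _; rewrite ler_wpM2l //.
by rewrite -[leLHS]real_normK ?num_real // lerXn2r ?nnegrE ?increment_bound.
Qed.

Lemma energy_step_le x h :
  `|energy (imb (D (x :: h))) - energy (imb (D h))| <=
  2 * (ss * kappa * c0) * radius h + ss * c0 ^+ 2.
Proof.
have r0 := radius_ge0 h.
have -> : 2 * (ss * kappa * c0) * radius h + ss * c0 ^+ 2 =
    \sum_i s i * (2 * ((kappa * radius h) * c0) + c0 ^+ 2).
  by rewrite -mulr_suml -/ss; ring.
rewrite /energy -sumrB (le_trans (ler_norm_sum _ _ _)) //; apply: ler_sum => i _.
rewrite imbalance_cons -mulrBr normrM ger0_norm // ler_wpM2l //.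
set x1 := imb _ _; set x2 := increment _ _ _.
have -> : (x1 + x2) ^+ 2 - x1 ^+ 2 = 2 * (x1 * x2) + x2 ^+ 2 by ring.
have h1 : `|x1| <= kappa * radius h by exact: imbalance_le_energy.
have h2 : `|x2| <= c0 by exact: increment_bound.
rewrite (le_trans (ler_normD _ _)) // lerD //.
  by rewrite normrM ger0_norm // ler_wpM2l // normrM ler_pM.
by rewrite ger0_norm ?sqr_ge0 // -[leLHS]real_normK ?num_real // lerXn2r ?nnegrE.
Qed.

Lemma lyapunov_step x y h :
  `|lyapunov (y :: x :: h) - lyapunov (x :: h)| <= a * (radius h + 1).
Proof.
have [a1 a2 a3 a4] := a_parts; have r0 := radius_ge0 h.
rewrite [lyapunov (y :: _)]/lyapunov [lyapunov (x :: _)]/lyapunov.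
have -> t1 t2 t3 t4 : t1 - 2 * t2 - (t3 - 2 * t4) = (t1 - t3) + (2 * t4 - 2 * t2) :> R.
  ring.
rewrite (le_trans (ler_normD _ _)) //.
have h1 := energy_step_le x h.
have h2 : `|2 * corr (imb (D h)) x - 2 * corr (imb (D (x :: h))) y| <=
    2 * (q * (kappa * radius h)) + 2 * (q * (kappa * radius h + c0)).
  rewrite (le_trans (ler_normB _ _)) // lerD // normrM ger0_norm // ler_wpM2l //.
    exact: corr_radius.
  apply: corr_bound => [|i]; first by rewrite addr_ge0 ?mulr_ge0.
  rewrite imbalance_cons (le_trans (ler_normD _ _)) // lerD ?increment_bound //.
  exact: imbalance_le_energy.
apply: le_trans (lerD h1 h2) _.
have m1 := mulr_ge0 a1 r0; have m2 := mulr_ge0 a2 r0.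
have m3 := mulr_ge0 a3 r0; have m4 := mulr_ge0 a4 r0.
rewrite -subr_ge0 (_ : _ - _ = 2 * (q * kappa * radius h) + ss * c0 ^+ 2 * radius h +
  2 * (q * c0 * radius h) + 6 * (q * kappa) + 2 * (ss * kappa * c0)).
  by lra.
by rewrite /a; ring.
Qed.

(** By the Poisson equation the correction trades [max_on e (ON x)] for its mean [corr e ord0]. What
    remains is at most [- 2 * delta] times the spread, up to the bounded terms in [c]. *)
Lemma lyapunov_drift x h :
  \sum_y K x y * (lyapunov (y :: x :: h) - lyapunov (x :: h)) <= c - b * radius h.
Proof.
have [K0 K1] := Ks.
set e := imb (D h); set e' := imb (D (x :: h)).
have -> : \sum_y K x y * (lyapunov (y :: x :: h) - lyapunov (x :: h)) =
    (energy e' - energy e + 2 * corr e x) - 2 * \sum_y K x y * corr e' y.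
  rewrite -[X in _ = X - _]mul1r -[X in _ = X * _ - _](K1 x) mulr_suml mulr_sumr.
  by rewrite -sumrB; apply: eq_bigr => y _; rewrite /=; ring.
have HP := HQ (fun z => max_on e (ON z)) x.
rewrite -/(corr e x) -/(corr e ord0) /= in HP.
have {}HP : corr e x - \sum_y K x y * corr e y = max_on e (ON x) - corr e ord0 := HP.
have Hc : \sum_y K x y * corr e y - \sum_y K x y * corr e' y <= q * c0.
  rewrite -sumrB; under eq_bigr do rewrite -mulrBr.
  apply: (stochastic_avg_le (f := fun y => corr e y - corr e' y)) => // y.
  apply: le_trans (ler_norm _) _; apply: corr_lipschitz => // i.
  by rewrite /e' imbalance_cons opprD addrA subrr sub0r normrN increment_bound.
have E := energy_cons x h; rewrite -/e -/e' in E.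
have Ei := energy_increment_le h x.
have [i [j]] := spread_ge_energy (imbalance_sum0 (D h)); rewrite -/e -/(radius h) => Hr.
have Hd := Hdrift e i j; rewrite -/(corr e ord0) in Hd.
have l0 : 0 < lambda by rewrite ltr_wpDr.
have Hb : delta / lambda * radius h <= delta * (e i - e j).
  by rewrite -mulrA ler_pM2l // mulrC ler_pdivrMr // mulrC.
have -> : b * radius h = 2 * (delta / lambda * radius h) by rewrite /b; ring.
move: E Ei HP Hc Hd Hb; rewrite /c.
set t1 := energy e'; set t2 := energy e; set t3 := energy _.
set t4 := corr e x; set t5 := corr e ord0; set t6 := \sum_y _; set t7 := \sum_y _.
set t8 := \sum_a _; set t9 := max_on _ _; set t10 := _ / _ * _.
set t11 := ss * _; set t12 := q * c0 => *; lra.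
Qed.

Lemma fourth_moment_imbalance (nu : 'I_k.+1 -> R) :
  (forall x, 0 <= nu x) -> \sum_x nu x = 1 ->
  exists C, 0 <= C /\ forall n i,
    path_expectation nu K n (fun h => imb (D (behead h)) i ^+ 4) <= C * n.+1%:R.
Proof.
move=> nu0 nu1; have [K0 K1] := Ks.
have [a1 a2 a3 a4] := a_parts.
have a0 : 0 <= a by rewrite /a; lra.
have l0 : 0 < lambda by rewrite ltr_wpDr.
have b0 : 0 < b by rewrite divr_gt0 // mulr_gt0.
have c00 : 0 <= c by rewrite /c; lra.
have [C [C0 HC]] := square_drift a0 b0 c00.
(* [phi] has bounded drift, so its mean grows at most linearly; being at least
   [(3 / 4 * r ^ 2) ^ 2], it controls [r ^ 4] and with it the fourth powers of the imbalances. *)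
pose phi h := (lyapunov h + a ^+ 2) ^+ 2.
have Hphi n : path_expectation nu K n phi <= path_expectation nu K 0 phi + C *+ n.
  apply: path_expectation_drift => // -[//|x h] _ /=.
  apply: (HC _ _ (fun y => lyapunov (y :: x :: h)) _ (radius h)) => //.
  - exact: lyapunov_size.
  - by move=> y; exact: lyapunov_step.
  - exact: lyapunov_drift.
exists (2 * kappa ^+ 4 * (`|path_expectation nu K 0 phi| + C)).
have k4 : 0 <= kappa ^+ 4 by rewrite exprn_ge0.
split=> [|n i]; first by rewrite mulr_ge0 ?addr_ge0 // mulr_ge0.
apply: (@le_trans _ _ (path_expectation nu K n (fun h => 2 * kappa ^+ 4 * phi h + 0))).
  apply: path_expectation_le => // -[//|x h] _; rewrite addr0 [behead _]/=.
  have := lyapunov_size x h; set W := lyapunov _; set r := radius h.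
  rewrite ler_norml => /andP[HW1 HW2].
  have r0 : 0 <= r := radius_ge0 h.
  have e1 : imb (D h) i ^+ 4 <= kappa ^+ 4 * r ^+ 4.
    rewrite -[X in _ ^+ X]/(2 * 2)%N exprM -[X in X ^+ 2]real_normK ?num_real //.
    rewrite -exprM -exprMn lerXn2r ?nnegrE ?mulr_ge0 //.
    exact: imbalance_le_energy.
  apply: le_trans e1 _; rewrite [2 * _]mulrC -[leRHS]mulrA ler_wpM2l //.
  have h1 : 3 / 4 * r ^+ 2 <= W + a ^+ 2 by have := sqr_ge0 (r / 2 - a); nra.
  have h2 : (3 / 4 * r ^+ 2) ^+ 2 <= phi (x :: h).
    by rewrite /phi -/W lerXn2r ?nnegrE // ?mulr_ge0 ?sqr_ge0 //; have := sqr_ge0 r; lra.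
  have r4 : 0 <= r ^+ 4 by rewrite exprn_ge0.
  apply: (@le_trans _ _ (2 * (3 / 4 * r ^+ 2) ^+ 2)); last by rewrite ler_wpM2l.
  by rewrite (_ : 2 * (3 / 4 * r ^+ 2) ^+ 2 = 9 / 8 * r ^+ 4); [lra|field].
rewrite path_expectation_affine // addr0 -[leRHS]mulrA ler_wpM2l ?mulr_ge0 //.
apply: le_trans (Hphi n) _; rewrite mulrDl lerD //.
  by rewrite (le_trans (ler_norm _)) // ler_peMr // ler1n.
by rewrite -[leLHS]mulr_natr ler_wpM2l // ler_nat.
Qed.

End Drift.

(** * Limit theorems *)

Local Open Scope classical_set_scope.

Lemma measurable_level (d : measure_display) (T : measurableType d) (R : realType)
    (f : T -> R) (r : R) :
  measurable_fun [set: T] f -> measurable [set w | r <= `|f w|].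
Proof.
move=> mf; have mN : measurable_fun setT (fun w => `|f w|) by exact: measurableT_comp.
rewrite (_ : [set w | _] = setT `&` (fun w => `|f w|) @^-1` `[r, +oo[).
  by apply: mN => //; exact: measurable_itv.
by rewrite setTI; apply/seteqP; split => w; rewrite /= in_itv /= andbT.
Qed.

(* [A h + f x], with [A] the centred sum over the past and [f] the solution of the
   Poisson equation, is a martingale with bounded increments. *)
Lemma second_moment_sum (R : realType) (k : nat) (K Q : 'M[R]_k.+1)
    (nu g : 'I_k.+1 -> R) :
  stochastic K -> (forall x, 0 <= nu x) -> \sum_x nu x = 1 ->
  (forall (g : 'I_k.+1 -> R) x, let f z := \sum_y Q z y * g y in
    f x - \sum_y K x y * f y = g x - f ord0) ->
  exists C, 0 <= C /\ forall n,
    path_expectation nu K n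
      (fun h => (\sum_(x <- h) (g x - \sum_y Q ord0 y * g y)) ^+ 2) <= C * n.+1%:R.
Proof.
move=> Ks nu0 nu1 /(_ g); set f := fun z => _ => /= HQ; have [K0 K1] := Ks.
rewrite -/(f ord0); pose psi x := g x - f ord0.
have {}HQ x : f x - \sum_y K x y * f y = psi x by exact: HQ.
pose M := \sum_x (`|psi x| + `|f x|).
have M0 : 0 <= M by rewrite sumr_ge0 // => x _; rewrite addr_ge0.
have MP x : `|psi x| + `|f x| <= M.
  by rewrite /M (bigD1 x) //= lerDl sumr_ge0 // => y _; rewrite addr_ge0.
have sqM (r b : R) : `|r| <= b -> r ^+ 2 <= b ^+ 2.
  move=> rb; rewrite -[leLHS]real_normK ?num_real // lerXn2r ?nnegrE //.
  exact: le_trans rb.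
pose A h := \sum_(x <- h) psi x.
(* [U] is the martingale: its increment [psi x - f x + f y] has conditional mean zero by the Poisson
   equation, which removes the cross term when the square is expanded. *)
pose U h := if h is x :: h' then A h' + f x else 0.
have HU n : path_expectation nu K n (fun h => U h ^+ 2) <=
    path_expectation nu K 0 (fun h => U h ^+ 2) + (3 * M) ^+ 2 *+ n.
  apply: path_expectation_drift => // -[//|x h] _; rewrite [head _ _]/=.
  have -> : \sum_y K x y * U [:: y, x & h] ^+ 2 = U (x :: h) ^+ 2 +
      2 * U (x :: h) * \sum_y K x y * (U [:: y, x & h] - U (x :: h)) +
      \sum_y K x y * (U [:: y, x & h] - U (x :: h)) ^+ 2.
    rewrite -[X in X + _ + _](mul1r (U (x :: h) ^+ 2)) -[X in X * _ + _ + _](K1 x).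
    rewrite mulr_suml mulr_sumr -!big_split /=.
    by apply: eq_bigr => y _; ring.
  have dU y : U [:: y, x & h] - U (x :: h) = psi x - f x + f y.
    by rewrite /U /A big_cons; ring.
  have -> : \sum_y K x y * (U [:: y, x & h] - U (x :: h)) = 0.
    under eq_bigr do rewrite dU mulrDr.
    by rewrite big_split /= -mulr_suml K1 mul1r -HQ; ring.
  rewrite mulr0 addr0 lerD2l.
  apply: (stochastic_avg_le (f := fun y => (U [:: y, x & h] - U (x :: h)) ^+ 2)) => // y.
  apply: sqM; rewrite dU (le_trans (ler_normD _ _)) //.
  have := ler_normB (psi x) (f x); have := MP x; have := MP y.
  by have := normr_ge0 (psi y); have := normr_ge0 (psi x); have := normr_ge0 (f x); lra.
set U0 := path_expectation nu K 0 _ in HU.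
exists (2 * (`|U0| + (3 * M) ^+ 2) + 2 * (3 * M) ^+ 2).
have M2 := sqr_ge0 (3 * M).
split=> [|n]; first by have := normr_ge0 U0; lra.
apply: (@le_trans _ _ (path_expectation nu K n
    (fun h => 2 * (U h ^+ 2) + 2 * (3 * M) ^+ 2))).
  apply: path_expectation_le => // -[//|x h] _; rewrite -/(A (x :: h)).
  have -> : A (x :: h) = U (x :: h) + (psi x - f x) by rewrite /U /A big_cons; ring.
  have : (psi x - f x) ^+ 2 <= (3 * M) ^+ 2.
    apply: sqM; have := ler_normB (psi x) (f x); have := MP x.
    by have := normr_ge0 (psi x); have := normr_ge0 (f x); lra.
  by have := sqr_ge0 (U (x :: h) - (psi x - f x)); nra.
rewrite path_expectation_affine // [leRHS]mulrDl lerD //; last by rewrite ler_peMr ?mulr_ge0 // ler1n.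
rewrite -[leRHS]mulrA ler_wpM2l // (le_trans (HU n)) // [leRHS]mulrDl lerD //.
  by rewrite (le_trans (ler_norm _)) // ler_peMr // ler1n.
by rewrite -[leLHS]mulr_natr ler_wpM2l // ler_nat.
Qed.

Lemma inverse_square_series_le (R : realType) (C : R) : 0 <= C ->
  (\sum_(0 <= n <oo) (C / n.+1%:R ^+ 2)%:E <= (2 * C)%:E)%E.
Proof.
move=> C0.
have t0 (n : nat) : 0 <= C / n.+1%:R ^+ 2 by rewrite divr_ge0 ?sqr_ge0.
apply: lime_le; first by apply: is_cvg_nneseries => n _ _; rewrite lee_fin.
apply: nearW => n; rewrite sumEFin lee_fin.
(* The bound is strengthened by a telescoping term so that induction goes through. *)
suff H : \sum_(0 <= i < n) C / i.+1%:R ^+ 2 <= 2 * C - 2 * C / n.+1%:R.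
  by rewrite (le_trans H) // gerBl divr_ge0 // mulr_ge0.
elim: n => [|n IH]; first by rewrite big_geq // divr1 subrr.
rewrite big_nat_recr //=; apply: le_trans (lerD IH (lexx _)) _.
have a0 : 0 < n.+1%:R :> R by rewrite ltr0n.
have b0 : 0 < n.+2%:R :> R by rewrite ltr0n.
have ba : n.+2%:R = n.+1%:R + 1 :> R by rewrite -natr1.
have a1 : 1 <= n.+1%:R :> R by rewrite ler1n.
move: a0 b0 ba a1; set a := n.+1%:R; set b := n.+2%:R => a0 b0 -> a1.
rewrite -subr_ge0.
have -> : 2 * C - 2 * C / (a + 1) - (2 * C - 2 * C / a + C / a ^+ 2) =
   C * (a - 1) / (a ^+ 2 * (a + 1)).
  by field; apply/andP; split; apply: lt0r_neq0; lra.
by rewrite divr_ge0 ?mulr_ge0 ?sqr_ge0 //; lra.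
Qed.

(** Borel-Cantelli at each level [1 / (m + 1)]: almost surely every one of these countably many
    levels is exceeded only finitely often. *)
Lemma ae_cvg0_inverse_square (d : measure_display) (T : measurableType d) (R : realType)
    (P : probability T R) (Y : nat -> T -> R) :
  (forall n, measurable_fun [set: T]%classic (Y n)) ->
  (forall eps, 0 < eps -> exists C, 0 <= C /\ forall n,
     (P [set w | eps <= `|Y n w|]%R%classic <= (C / n.+1%:R ^+ 2)%:E)%E) ->
  cvg_as P Y 0.
Proof.
move=> mY HY.
pose F (m n : nat) := [set w | (m.+1%:R^-1 : R) <= `|Y n w|]%classic.
have mF m n : measurable (F m n) by exact: measurable_level.
have F0 m : P (lim_sup_set (F m)) = 0%E.
  apply: lim_sup_set_cvg0 => //.
  have [C [C0 HC]] := HY m.+1%:R^-1 (ltac:(by rewrite invr_gt0 ltr0n)).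
  apply: (@le_lt_trans _ _ (2 * C)%:E); last exact: ltry.
  apply: le_trans (inverse_square_series_le C0).
  by apply: lee_nneseries => [n _ _|n _]; [exact: measure_ge0|exact: HC].
have mL m : measurable (lim_sup_set (F m)).
  by apply: bigcap_measurable => // n _; exact: bigcup_measurable.
have HF m : {ae P, forall w, (\forall n \near \oo, `|Y n w|%R < m.+1%:R^-1)%classic}.
  apply: (@negligibleS _ _ _ _ (lim_sup_set (F m))) => [w Hw N _|]; last exact/(negligibleP _ (mL m))/F0.
  apply: contrapT => HN; apply: Hw; exists N => //= n Nn.
  by rewrite ltNge; apply/negP => FY; apply: HN; exists n.
apply: filterS (ae_foralln HF) => w Hw /=.
apply/cvgr0Pnorm_lt => eps eps0.
have [m _ Hm] := near_infty_natSinv_lt (PosNum eps0).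
apply: filterS (Hw m) => n /lt_trans; apply; exact: (Hm m (leqnn m)).
Qed.

(** Heine's theorem by compactness, in the form where only [x] is confined to the segment and [y]
    may leave it. *)
Lemma uniform_continuity_segment (R : realType) (f : R -> R) (A eps : R) :
  continuous f -> 0 < eps ->
  exists delta, 0 < delta /\ forall x y, `|x| <= A -> `|y - x| < delta ->
    `|f y - f x| < eps.
Proof.
move=> cf e0.
have /compact_near_coveringP := @segment_compact R (- A) A.
move=> /(_ R (0^'+) (fun r x => forall y, `|y - x| < r -> `|f y - f x| < eps)).
have FF : Filter (0^'+ : set_system R) by exact: _.
move=> /(_ FF) H; have [|r0 r00 Hr] := H.
  move=> x _.
  have [r /= rpos Hr] := (@cvgrPdist_lt _ _ _ _ _ _ _).1 (cf x) (eps / 2) (ltac:(lra)).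
  exists (ball x (r / 2), [set i | 0 < i < r / 2]) => /=.
    split; first by apply: nbhsx_ballx; lra.
    exists (r / 2) => /= [|i]; first lra.
    by rewrite /= sub0r normrN => /ltr_normlW ir i0; apply/andP.
  move=> [z i] /= [xz /andP[i0 ir]] y yz; rewrite /ball /= in xz.
  have h1 : `|f x - f z| < eps / 2 by apply: Hr; rewrite /ball /=; lra.
  have h2 : `|f x - f y| < eps / 2.
    apply: Hr; rewrite /ball /= (_ : x - y = (x - z) - (y - z)); last by ring.
    by rewrite (le_lt_trans (ler_normB _ _)) //; lra.
  rewrite (_ : f y - f z = (f x - f z) - (f x - f y)); last by ring.
  by rewrite (le_lt_trans (ler_normB _ _)) //; lra.
exists (r0 / 2); split=> [|x y xA xy]; first by rewrite /= in r00; lra.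
rewrite /= in r00; apply: (Hr (r0 / 2)) xy.
- by rewrite /ball /= sub0r normrN ger0_norm; lra.
- lra.
- by rewrite /= in_itv /= -ler_norml.
Qed.

(** * Convergence in law and Slutsky's theorem *)

Lemma bounded_integrable_probability (d : measure_display) (T : measurableType d)
    (R : realType) (P : probability T R) (f : T -> R) (M : R) :
  measurable_fun [set: T] f -> (forall x, `|f x| <= M) ->
  P.-integrable [set: T] (EFin \o f).
Proof.
move=> mf fM; apply: measurable_bounded_integrable => //.
  exact: le_lt_trans (probability_le1 P measurableT) (ltry _).
exists M; split; first exact: num_real.
by move=> x Mx y _; exact: le_trans (fM y) (ltW Mx).
Qed.

(** Multiplication by [c] gets a name so that it can carry the structure of a measurable function
    which [distribution] expects. *)
Definition scale_by (R : realType) (c : R) :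
  measurableTypeR R -> measurableTypeR R := fun x : R => c * x.

Lemma measurable_scale_by (R : realType) (c : R) :
  measurable_fun [set: measurableTypeR R] (scale_by c).
Proof. exact: mulrl_measurable. Qed.

HB.instance Definition _ (R : realType) (c : R) :=
  @isMeasurableFun.Build _ _ _ _ (scale_by c) (measurable_scale_by c).

Section Slutsky.
Variables (d : measure_display) (T : measurableType d) (R : realType).
Variables (P : probability T R) (L : probability (measurableTypeR R) R) (c : R).

Definition scaled_law : probability (measurableTypeR R) R :=
  distribution L (scale_by c).

Lemma expectation_scaled_law (f : R -> R) (M : R) :
  continuous f -> (forall x, `|f x| <= M) ->
  ('E_scaled_law[f] = 'E_L[fun x => (f (c * x))%R])%E.
Proof.
move=> cf fM; have mf : measurable_fun [set: measurableTypeR R] f.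
  exact: continuous_measurable_fun.
rewrite unlock /scaled_law (integral_distribution (X := scale_by c)) //.
  exact/measurable_EFinP.
apply: (@bounded_integrable_probability _ _ _ _ (f \o scale_by c) M).
  by apply: (measurableT_comp mf); exact: measurable_scale_by.
by move=> x; exact: fM.
Qed.

Lemma scaled_law_second_moment :
  ('E_scaled_law[fun x => (x ^+ 2)%R] = (c ^+ 2)%:E * 'E_L[fun x => (x ^+ 2)%R])%E.
Proof.
have m2 : measurable_fun [set: measurableTypeR R] (fun x : R => (x ^+ 2)%:E).
  apply/measurable_EFinP; exact: exprn_measurable.
rewrite unlock /scaled_law (@ge0_integral_distribution _ _ _ _ _ L (scale_by c)) //; last first.
  by move=> y; rewrite lee_fin sqr_ge0.
rewrite -ge0_integralZl //; last 2 first.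
  by move=> x _; rewrite lee_fin sqr_ge0.
  by rewrite lee_fin sqr_ge0.
by apply: eq_integral => x _; rewrite /= /scale_by -EFinM exprMn.
Qed.

(** A continuous substitute for the indicator of [|x| > A]: it is 0 for [|x| <= A] and 1 for
    [|x| >= A + 1]. Convergence in law can be tested on it. *)
Let tail (A x : R) : R := Num.min 1 (Num.max 0 (`|x| - A)).

Let tail_ge0 A x : 0 <= tail A x.
Proof. by rewrite /tail le_min ler01 le_max lexx. Qed.

Let tail_le1 A x : tail A x <= 1.
Proof. by rewrite /tail ge_min lexx. Qed.

Let tail_continuous A : continuous (tail A).
Proof.
move=> x.
have h1 : {for x, continuous (fun y : R => `|y| - A : R^o)}.
  by apply: cvgB; [exact: cvg_norm|exact: cvg_cst].
have cst_cont (r : R) : {for x, continuous (cst r : R -> R^o)} by exact: cvg_cst.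
exact: continuous_min (cst_cont 1) (continuous_max (cst_cont 0) h1).
Qed.

Let tail_bounded A x : `|tail A x| <= 1.
Proof. by rewrite ger0_norm. Qed.

Lemma tail_expectation_cvg0 (mu : probability (measurableTypeR R) R) (eps : R) :
  0 < eps -> exists A, ('E_mu[tail A] < eps%:E)%E.
Proof.
move=> e0.
have : ('E_mu[tail n%:R] @[n --> \oo] --> 0)%E.
  rewrite -[X in _ --> X](expectation_cst mu 0) unlock.
  have mt n : measurable_fun [set: measurableTypeR R] (fun x => (tail n%:R x)%:E).
    apply/measurable_EFinP; apply: continuous_measurable_fun.
    exact: tail_continuous.
  have tail0 : {ae mu, forall x, [set: measurableTypeR R] x ->
      (tail n%:R x)%:E @[n --> \oo] --> (0 : R)%:E}.
    apply: aeW => x _; apply: cvg_near_cst.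
    near=> n; congr (_%:E); rewrite /tail max_l; last first.
      by rewrite subr_le0; near: n; exact: nbhs_infty_ger.
    by rewrite min_r.
  have tail1 : {ae mu, forall x n, [set: measurableTypeR R] x ->
      (`|(tail n%:R x)%:E| <= (1 : R)%:E)%E}.
    by apply: aeW => x n _; rewrite /= lee_fin.
  have [] := dominated_convergence measurableT mt (measurable_cst _) tail0
    (finite_measure_integrable_cst _ _ measurableT) tail1.
  by [].
move=> /(_ [set y | (y < eps%:E)%E]) [].
  by apply: open_nbhs_nbhs; split; [exact: open_ereal_lt_ereal|rewrite /= lte_fin].
by move=> n _ /(_ n (leqnn n)) Hn; exists n%:R.
Unshelve. all: by end_near.
Qed.

(** The three summands stand for three cases: [V] moderate and [U] close to it, where [f] is
    uniformly continuous; [U] far from [V]; and [V] large, where [tail A] equals 1. *)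
Lemma expectation_dist_le (f : R -> R) (M eta delta A : R) (U V : T -> R) :
  continuous f -> (forall x, `|f x| <= M) -> 0 <= eta ->
  (forall x y, `|x| <= A + 1 -> `|y - x| < delta -> `|f y - f x| < eta) ->
  measurable_fun [set: T] U -> measurable_fun [set: T] V ->
  `|fine 'E_P[f \o U]%E - fine 'E_P[f \o V]%E| <=
  eta + 2 * M * fine (P [set w | delta <= `|U w - V w|]) +
    2 * M * fine 'E_P[tail A \o V]%E.
Proof.
move=> cf fM eta0 Hunif mU mV.
have M0 : 0 <= M := le_trans (normr_ge0 _) (fM 0).
have mf : measurable_fun setT f by exact: continuous_measurable_fun.
set B := [set w | _].
have mB : measurable B.
  by apply: (measurable_level (f := fun w => U w - V w)); exact: measurable_funB.
have iU : P.-integrable setT (EFin \o (f \o U)).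
  apply: (@bounded_integrable_probability _ _ _ _ _ M); first exact: measurableT_comp mf mU.
  by move=> x; exact: fM.
have iV : P.-integrable setT (EFin \o (f \o V)).
  apply: (@bounded_integrable_probability _ _ _ _ _ M); first exact: measurableT_comp mf mV.
  by move=> x; exact: fM.
have iB : P.-integrable setT (EFin \o (\1_B : T -> R)).
  apply: (@bounded_integrable_probability _ _ _ _ _ 1) => // x.
  by rewrite indicE ger0_norm //; case: (_ \in _).
have itail : P.-integrable setT (EFin \o (tail A \o V)).
  apply: (@bounded_integrable_probability _ _ _ _ _ 1) => [|x]; last exact: tail_bounded.
  apply: (measurableT_comp _ mV); apply: continuous_measurable_fun.
  exact: tail_continuous.
have scaleI (g : T -> R) r : P.-integrable setT (EFin \o g) ->
    P.-integrable setT (EFin \o (fun w => r * g w)).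
  by move=> ig; exact: (integrableZl measurableT r ig).
have addI (g h : T -> R) : P.-integrable setT (EFin \o g) ->
    P.-integrable setT (EFin \o h) -> P.-integrable setT (EFin \o (fun w => g w + h w)).
  by move=> ig ih; exact: (integrableD measurableT ig ih).
have iB2 := scaleI _ (2 * M) iB; have itail2 := scaleI _ (2 * M) itail.
have ieta : P.-integrable setT (EFin \o (cst eta : T -> R)).
  exact: finite_measure_integrable_cst.
rewrite unlock -!/(Rintegral P setT _) -RintegralB //.
have iUV : P.-integrable setT (EFin \o (fun w => (f \o U) w - (f \o V) w)).
  exact: (integrableB measurableT iU iV).
apply: le_trans (le_normr_Rintegral measurableT iUV) _.
have -> : fine (P B) = Rintegral P setT (\1_B : T -> R).
  by rewrite /Rintegral integral_indic // setIT.
have eR : eta = Rintegral P setT (cst eta).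
  have P1 : fine (P setT) = 1 by rewrite probability_setT.
  by rewrite Rintegral_cst // -[LHS]mulr1; congr (_ * _); rewrite -[LHS]P1.
rewrite -!RintegralZl // [X in X + _ + _]eR -RintegralD // -RintegralD //; last exact: addI.
apply: le_Rintegral => //.
- exact: integrable_norm iUV.
- exact: (addI _ _ (addI _ _ ieta iB2) itail2).
move=> w _.
change (`|f (U w) - f (V w)| <= eta + 2 * M * \1_B w + 2 * M * tail A (V w)).
have tw : 0 <= 2 * M * tail A (V w) by rewrite mulr_ge0 // mulr_ge0.
have bw : 0 <= 2 * M * \1_B w by rewrite !mulr_ge0.
have fw : `|f (U w) - f (V w)| <= 2 * M.
  by rewrite (le_trans (ler_normB _ _)) //; have := fM (U w); have := fM (V w); lra.
have [UVw|UVw] := leP delta `|U w - V w|.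
  by have -> : \1_B w = 1 :> R; [rewrite indicE mem_set|lra].
have [Vw|Vw] := leP `|V w| (A + 1); first by have := Hunif _ _ Vw UVw; lra.
rewrite (_ : tail A (V w) = 1); first lra.
by rewrite /tail min_l // le_max; apply/orP; right; lra.
Qed.

Lemma slutsky (W Y : nat -> T -> R) :
  cvg_in_law P W L -> (forall n, measurable_fun [set: T] (Y n)) ->
  (forall eps : R, 0 < eps ->
     (P [set w | (eps <= `|Y n w - c * W n w|)%R] @[n --> \oo] --> 0)%E) ->
  cvg_in_law P Y scaled_law.
Proof.
move=> [mW WL] mY HP; split=> // f cf [M0 fM0].
pose M := Num.max 1 M0.
have M1 : 1 <= M by rewrite le_max lexx.
have fM x : `|f x| <= M by rewrite le_max fM0 orbT.
have mcW n : measurable_fun setT (fun w => c * W n w).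
  by apply: measurableT_comp => //; exact: mulrl_measurable.
have finE (D : measure_display) (T' : measurableType D) (Q : probability T' R)
    (g : T' -> R) (Mg : R) :
    measurable_fun setT g -> (forall x, `|g x| <= Mg) -> 'E_Q[g]%E \is a fin_num.
  move=> mg gM; rewrite unlock integrable_fin_num //.
  exact: bounded_integrable_probability mg gM.
have scaled (g : R -> R) (Mg : R) : continuous g -> (forall x, `|g x| <= Mg) ->
    fine 'E_P[g \o (fun w => (c * W n w)%R)]%E @[n --> \oo] --> fine 'E_scaled_law[g]%E.
  move=> cg gM; rewrite (expectation_scaled_law cg gM).
  have cgc : continuous (fun x => g (c * x)).
    by move=> x; apply: (continuous_comp (g := g)); [exact: mulrl_continuous|exact: cg].
  apply: fine_cvg; rewrite fineK.
    by apply: (WL (fun x => g (c * x))) => //; exists Mg => x.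
  apply: (finE _ _ _ _ Mg) => [|x]; last exact: gM.
  exact: continuous_measurable_fun.
have mf : measurable_fun setT f by exact: continuous_measurable_fun.
rewrite -(fineK (finE _ _ scaled_law f M mf fM)); apply/fine_cvgP; split.
  by apply: nearW => n; apply: (finE _ _ _ _ M) => [|x]; [exact: measurableT_comp mf (mY n)|exact: fM].
apply/cvgrPdist_lt => eps eps0.
(* The errors add up to less than [eps]: [eps / 4] from the convergence for [c * W], [eps / 8] from
   uniform continuity, and [2 * M * kap + 4 * M * kap = 3 * eps / 8] from the two exceptional
   events. *)
pose kap := eps / (16 * M).
have kap0 : 0 < kap by rewrite divr_gt0 //; lra.
have kapE : M * kap = eps / 16 by rewrite /kap; field; lra.
have [A HA] := tail_expectation_cvg0 scaled_law kap0.
have tfin : 'E_scaled_law[tail A]%E \is a fin_num.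
  apply: (finE _ _ _ _ 1) => [|x]; last exact: tail_bounded.
  apply: continuous_measurable_fun; exact: tail_continuous.
have {}HA : fine 'E_scaled_law[tail A]%E < kap by rewrite -lte_fin fineK.
have [delta [delta0 Hunif]] := @uniform_continuity_segment R f (A + 1) (eps / 8) cf (ltac:(lra)).
have pcvg : fine (P [set w | (delta <= `|Y n w - c * W n w|)%R]) @[n --> \oo] --> (0 : R).
  exact: fine_cvg (HP _ delta0).
(* Tightness: [A] is chosen for the limit law alone, and convergence in law transfers the bound to
   [c * W n] for large [n]. *)
have tcvg := scaled (tail A) 1 (@tail_continuous A) (tail_bounded A).
near=> n.
have h1 : `|fine 'E_scaled_law[f]%E - fine 'E_P[f \o (fun w => (c * W n w)%R)]%E| < eps / 4.
  near: n; apply: (@cvgrPdist_lt _ _ _ _ _ _ _).1 (scaled f M cf fM) _ _; lra.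
have h2 : `|fine 'E_scaled_law[tail A]%E -
    fine 'E_P[tail A \o (fun w => (c * W n w)%R)]%E| < kap.
  by near: n; exact: (@cvgrPdist_lt _ _ _ _ _ _ _).1 tcvg _ _.
have h3 : `|fine (P [set w | (delta <= `|Y n w - c * W n w|)%R])| < kap.
  by near: n; exact: (@cvgr0Pnorm_lt _ _ _ _ _ _).1 pcvg _ kap0.
have h4 := expectation_dist_le cf fM (ltac:(lra) : 0 <= eps / 8) Hunif (mY n) (mcW n).
rewrite /= -/(f \o Y n).
set l := fine _ in h1 *; set y := fine 'E_P[f \o Y n]%E in h4 *.
set v := fine _ in h1 h4; set p := fine _ in h3 h4; have HA2 := HA; set t0 := fine _ in HA2 h2.
set t := fine _ in h2 h4.
have p1 : p <= kap by rewrite (le_trans (ler_norm _)) // ltW.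
have t1 : t <= 2 * kap by move: h2; rewrite ltr_norml => /andP[]; lra.
have hp : M * p <= M * kap by rewrite ler_wpM2l //; lra.
have ht : M * t <= M * (2 * kap) by rewrite ler_wpM2l //; lra.
rewrite (_ : l - y = (l - v) - (y - v)); last by ring.
by rewrite (le_lt_trans (ler_normB _ _)) //; lra.
Unshelve. all: by end_near.
Qed.

End Slutsky.

(** * The policy *)

Section Model.
Variables (T : Type) (R : realType) (N k : nat).
Variables (X Z : 'I_N -> nat -> T -> bool) (xi : nat -> T -> 'I_k.+1).
Variables (g : 'I_k.+1 -> 'I_N -> bool) (mu sigma2 : 'I_N -> R).
Variable tie : {set 'I_N} -> 'I_N.
Hypothesis HX : forall i t w, (0 < t)%N -> X i t w = g (xi t w) i.
Hypothesis HZ : vwd_policy tie mu sigma2 X Z.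

Local Notation ON := (fun x => finset (g x)).

Lemma on_clientsE t w : (0 < t)%N -> on_clients X t w = ON (xi t w).
Proof. by move=> t0; apply/setP => i; rewrite !inE HX. Qed.

Lemma deficitS t w i : deficit Z mu t.+1 w i =
  deficit Z mu t w i + (mu i - (Z i t.+1 w)%:R).
Proof. by rewrite /deficit big_nat_recr //= -natr1; ring. Qed.

Lemma deficit_history t w :
  deficit Z mu t w = history_deficit mu sigma2 tie ON (history xi t w).
Proof.
elim: t => [|t IH]; apply/funext => i.
  by rewrite /deficit big_geq // mul0r subrr.
by rewrite deficitS HZ //= on_clientsE // IH.
Qed.

Lemma subset_channelE (S : {set 'I_N}) t w : (0 < t)%N ->
  subset_channel X S t w = (S :&: ON (xi t w) != finset.set0).
Proof.
move=> t0; rewrite /subset_channel big_orE; apply/existsP/set0Pn => -[i].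
  by rewrite HX // => /andP[iS gi]; exists i; rewrite !inE iS.
by rewrite !inE => /andP[iS gi]; exists i; rewrite HX // iS.
Qed.

Lemma sum_channel_history (S : {set 'I_N}) n w :
  \sum_(1 <= t < n.+1) (subset_channel X S t w)%:R =
  \sum_(x <- history xi n w) (S :&: ON x != finset.set0)%:R :> R.
Proof.
elim: n => [|n IH]; first by rewrite big_geq // big_nil.
by rewrite big_nat_recr //= IH big_cons subset_channelE // addrC.
Qed.

(** Exactly one packet is delivered in each slot with an ON channel, whoever receives it, so the
    total deficit depends only on the channels. *)
Lemma sum_deficit t w :
  \sum_i deficit Z mu t w i = t%:R * \sum_i mu i -
    \sum_(1 <= u < t.+1) (subset_channel X [set: 'I_N]%SET u w)%:R.
Proof.
elim: t => [|t IH].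
  by rewrite big_geq // mul0r subrr big1 // => i _; rewrite /deficit big_geq // mul0r subrr.
under eq_bigr do rewrite deficitS.
rewrite big_split /= IH sumrB -natr1 [in RHS]big_nat_recr //=.
suff -> : \sum_i (Z i t.+1 w)%:R = (subset_channel X [set: 'I_N]%SET t.+1 w)%:R :> R.
  by ring.
rewrite subset_channelE // finset.setTI -on_clientsE //.
under eq_bigr do rewrite HZ //.
case: (on_clients X t.+1 w != finset.set0) => /=; last by rewrite big1.
set i0 := tie _; rewrite (bigD1 i0) //= eqxx big1 ?addr0 // => i ii0.
by rewrite (negbTE ii0).
Qed.

End Model.


(** * Stationary means and tails of the imbalances *)

Lemma ae_const_eq (d : measure_display) (T : measurableType d) (R : realType)
    (P : probability T R) (p : Prop) : {ae P, forall w, p} -> p.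
Proof.
move=> H; apply: contrapT => np; have [A [mA PA sub]] := H.
have : P setT = 0%E.
  apply/eqP; rewrite -measure_le0 -PA le_measure ?inE // => w _.
  by apply: sub.
by rewrite probability_setT => /eqP; rewrite onee_eq0.
Qed.

(* The value at [ord0] of the solution [Q f] of the Poisson equation is the stationary
   mean of [f]. *)
Lemma time_average_limit (d : measure_display) (T : measurableType d) (R : realType)
    (P : probability T R) (k : nat) (K Q : 'M[R]_k.+1) (xi : nat -> T -> 'I_k.+1)
    (f : 'I_k.+1 -> R) (a : R) :
  stochastic K -> markov_chain P K xi ->
  (forall (g : 'I_k.+1 -> R) x, let f z := \sum_y Q z y * g y in
    f x - \sum_y K x y * f y = g x - f ord0) ->
  cvg_as P (fun n w => (\sum_(x <- history xi n w) f x) / n%:R) a ->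
  a = \sum_y Q ord0 y * f y.
Proof.
move=> Ks Hxi HQ Ha; set l := \sum_y _.
have [C [C0 HC]] := second_moment_sum f Ks (initial_law_ge0 P xi)
  (initial_law_sum1 Hxi) HQ.
rewrite -/l in HC.
(* Chebyshev's bound at time [n] is only of order [1 / n]; along the squares it is summable. A
   subsequence suffices, because the limit [a] is known to exist. *)
pose sq n := (n.+1 ^ 2)%N.
pose Y n w := (\sum_(x <- history xi (sq n) w) (f x - l)) / (sq n)%:R.
have sq0 n : 0 < (sq n)%:R :> R by rewrite ltr0n expn_gt0.
have Y0 : cvg_as P Y 0.
  apply: ae_cvg0_inverse_square => [n|eps e0].
    exact: (measurable_fun_history Hxi (sq n)
      (fun h => (\sum_(x <- h) (f x - l)) / (sq n)%:R)).
  exists (C / eps ^+ 2); split=> [|n]; first by rewrite divr_ge0 ?sqr_ge0.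
  have sqE : sq n = (sq n).-1.+1 by rewrite prednK // expn_gt0.
  pose phi h := (\sum_(x <- h) (f x - l)) ^+ 2.
  have ae0 : 0 < (eps * (sq n)%:R) ^+ 2 by rewrite exprn_gt0 // mulr_gt0.
  have := history_markov Ks Hxi (sq n).-1 (fun h => sqr_ge0 _ : 0 <= phi h) ae0.
  rewrite -sqE => H; apply: le_trans (le_trans _ H) _.
    apply: le_measure; rewrite ?inE.
    - apply: measurable_level.
      exact: (measurable_fun_history Hxi (sq n)
        (fun h => (\sum_(x <- h) (f x - l)) / (sq n)%:R)).
    - exact: (measurable_history Hxi (sq n) (fun h => (eps * (sq n)%:R) ^+ 2 <= phi h)).
    move=> w /=; rewrite /Y normrM normfV (gtr0_norm (sq0 n)) ler_pdivlMr // => H1.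
    rewrite /phi -[leRHS]real_normK ?num_real // lerXn2r ?nnegrE //.
    by rewrite mulr_ge0 // ltW.
  rewrite lee_fin.
  apply: (@le_trans _ _ (C * (sq n)%:R / (eps * (sq n)%:R) ^+ 2)).
    by rewrite ler_wpM2r ?invr_ge0 ?sqr_ge0 // (le_trans (HC _)) // -sqE.
  rewrite le_eqVlt; apply/orP; left; apply/eqP.
  rewrite (_ : (sq n)%:R = n.+1%:R ^+ 2 :> R); last by rewrite -natrX.
  by field; rewrite gt_eqF //=  ?andbT ?pnatr_eq0 // gt_eqF.
apply: (@ae_const_eq _ T R P); apply: filterS2 Ha Y0 => w Haw HYw.
have sqoo : sq @ \oo --> \oo.
  apply/cvgnyPge => A; near=> n; rewrite (@leq_trans n.+1) //.
    by rewrite ltnW // ltnS; near: n; exact: nbhs_infty_ge.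
  by rewrite /sq -[leqLHS]expn1 leq_pexp2l.
have H1 : ((\sum_(x <- history xi (sq n) w) f x) / (sq n)%:R - l @[n --> \oo] --> a - l)%classic.
  by apply: cvgB; [exact: (cvg_comp _ _ sqoo Haw)|exact: cvg_cst].
have H2 : (Y n w @[n --> \oo] --> a - l)%classic.
  suff -> : (fun n => Y n w) = (fun n => (\sum_(x <- history xi (sq n) w) f x) / (sq n)%:R - l) by [].
  apply/funext => n; rewrite /Y.
  have -> (h : seq 'I_k.+1) : \sum_(x <- h) (f x - l) =
      \sum_(x <- h) f x - l * (size h)%:R.
    elim: h => [|x h IH]; first by rewrite !big_nil mulr0 subr0.
    by rewrite !big_cons IH /= -[(size h).+1%:R]natr1; ring.
  by rewrite size_history mulrBl mulfK // gt_eqF.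
by apply/eqP; rewrite -subr_eq0; apply/eqP; exact: (cvg_unique _ H2 HYw).
Unshelve. all: by end_near.
Qed.

(** Gathers what the conclusion needs from the chain, so that the chain does not appear afterwards.
    The tail bound is Markov's inequality for the fourth power of the imbalance. *)
Lemma vwd_imbalance_tail (d : measure_display) (T : measurableType d) (R : realType)
    (P : probability T R) (N : nat) (X Z : 'I_N -> nat -> T -> bool)
    (m v2 : {set 'I_N} -> R) (mu sigma2 : 'I_N -> R) (tie : {set 'I_N} -> 'I_N) :
  (0 < N)%N -> markov_channels P X -> second_order_model P X m v2 ->
  (forall S : {set 'I_N}, S != finset.set0 -> S \proper [set: 'I_N]%SET ->
     \sum_(i in S) mu i < m S) ->
  \sum_i mu i = m [set: 'I_N]%SET ->
  (forall i, 0 < sigma2 i) -> tie_breaking tie -> vwd_policy tie mu sigma2 X Z ->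
  [/\ forall n i, measurable_fun [set: T] (fun w => deficit Z mu n w i),
      forall n w, \sum_i deficit Z mu n w i = n%:R * m [set: 'I_N]%SET -
        \sum_(1 <= u < n.+1) (subset_channel X [set: 'I_N]%SET u w)%:R &
      exists C, 0 <= C /\ forall n i r, 0 < r ->
        (P [set w | (r <= `|imbalance sigma2 (deficit Z mu n w) i|)%R] <=
         (C * n.+1%:R / r ^+ 4)%:E)%E].
Proof.
move=> N0 [k [K [xi [g [Ks Ki _ Hxi HX]]]]] Hmodel Hsub Hfull Hs0 Htie HZ.
pose ON x := finset (g x).
have [Q HQ] := poisson_equation Ks Ki.
have mE (S : {set 'I_N}) :
    m S = \sum_y Q ord0 y * (S :&: ON y != finset.set0)%:R.
  apply: (time_average_limit Ks Hxi HQ); have [Hm _] := Hmodel S.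
  apply: filterS Hm => w; rewrite /time_average.
  by under eq_fun do rewrite (sum_channel_history R HX).
pose proper_set (S : {set 'I_N}) := (S != finset.set0) && (S != [set: 'I_N]%SET).
(* The smallest slack in the strict capacity conditions; the default 1 keeps it positive when there
   is no proper nonempty set. *)
pose delta := \big[Num.min/1]_(S | proper_set S) (m S - \sum_(i in S) mu i).
have delta0 : 0 < delta.
  apply: lt_bigmin => // S /andP[S0 ST]; rewrite subr_gt0 Hsub //.
  by rewrite finset.properT.
have Hdrift := max_weight_drift (ltW delta0) (mu := mu) (ON := ON) (l := Q ord0).
have {}Hdrift (e : 'I_N -> R) i j : \sum_a e a * mu a + delta * (e i - e j) <=
    \sum_x Q ord0 x * max_on e (ON x).
  apply: Hdrift => [S S0 ST|]; rewrite -mE //.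
  have : delta <= m S - \sum_(i in S) mu i by apply: bigmin_le_cond; rewrite /proper_set S0.
  by lra.
have [C [C0 HC]] := fourth_moment_imbalance (Ordinal N0) Ks Hs0 Htie delta0 HQ Hdrift
  (initial_law_ge0 P xi) (initial_law_sum1 Hxi).
have mdef n i : measurable_fun [set: T] (fun w => deficit Z mu n w i).
  under eq_fun do rewrite (deficit_history HX HZ).
  exact: (measurable_fun_history Hxi n (fun h => history_deficit mu sigma2 tie ON h i)).
split=> // [n w|]; first by rewrite (sum_deficit HX HZ) Hfull.
exists C; split=> // n i r r0.
(* The deficits after [n] slots are read from the history of [n + 1] slots without its head, whence
   the factor [n + 1]. *)
pose phi h := imbalance sigma2 (history_deficit mu sigma2 tie ON (behead h)) i ^+ 4.
have phi0 h : 0 <= phi h by rewrite /phi -[4%N]/(2 * 2)%N exprM sqr_ge0.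
have r40 : 0 < r ^+ 4 by rewrite exprn_gt0.
have E w : (r <= `|imbalance sigma2 (deficit Z mu n w) i|) =
    (r ^+ 4 <= phi (history xi n.+1 w)).
  rewrite (deficit_history HX HZ) -[phi _](ger0_norm (phi0 _)) /phi normrX.
  by rewrite ler_pXn2r // ?nnegrE // ltW.
rewrite (_ : [set w | _] = [set w | r ^+ 4 <= phi (history xi n.+1 w)]); last first.
  by apply/seteqP; split=> w /=; rewrite E.
apply: le_trans (history_markov Ks Hxi n phi0 r40) _.
by rewrite lee_fin ler_wpM2r ?invr_ge0 ?(ltW r40) //; exact: HC.
Qed.

Theorem theorem4 (d : measure_display) (T : measurableType d) (R : realType)
    (P : probability T R) (N : nat) (X Z : 'I_N -> nat -> T -> bool)
    (m v2 : {set 'I_N} -> R) (mu sigma2 : 'I_N -> R)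
    (tie : {set 'I_N} -> 'I_N)
    (HX : markov_channels P X)
    (Hmodel : second_order_model P X m v2)
    (Hsub : forall S : {set 'I_N}, S != finset.set0 -> S \proper [set: 'I_N]%SET ->
       \sum_(i in S) mu i < m S)
    (Hfull : \sum_i mu i = m [set: 'I_N]%SET)
    (Hsigma : \sum_i Num.sqrt (sigma2 i) >= Num.sqrt (v2 [set: 'I_N]%SET))
    (Hmu0 : forall i, 0 <= mu i)
    (Hsigma0 : forall i, 0 < sigma2 i)
    (Htie : tie_breaking tie)
    (HZ : vwd_policy tie mu sigma2 X Z) :
  forall i : 'I_N,
    cvg_as P (time_average R (Z i)) (mu i) /\
    exists L : probability (measurableTypeR R) R,
      cvg_in_law P (scaled_deviation (Z i) (mu i)) L /\
      ('E_L[fun x => (x ^+ 2)%R] <= (sigma2 i)%:E)%E.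
Proof.
move=> i; have N0 : (0 < N)%N := leq_ltn_trans (leq0n i) (ltn_ord i).
have [mdef sumD [C [C0 tail]]] :=
  vwd_imbalance_tail N0 HX Hmodel Hsub Hfull Hsigma0 Htie HZ.
have [asF [L [lawF EL]]] := Hmodel [set: 'I_N]%SET.
set mF := m _ in sumD asF lawF; set XF := subset_channel X _ in sumD asF lawF.
pose s j := Num.sqrt (sigma2 j); pose ss := \sum_j s j; pose c := s i / ss.
have s0 j : 0 < s j by rewrite sqrtr_gt0.
have ss0 : 0 < ss by rewrite /ss (bigD1 i) //= ltr_pwDl // sumr_ge0 // => j _; exact: ltW.
pose e n w := imbalance sigma2 (deficit Z mu n w) i.
have me n : measurable_fun [set: T] (e n).
  apply: measurable_funB; first by apply: measurable_funM => //; exact: mdef.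
  by apply: measurable_funM => //; apply: measurable_sum => j; exact: mdef.
(* The main decomposition: the deviation of client [i] is the fraction [c] of the deviation of the
   full channel, up to its own imbalance. Both limits follow from it. *)
have sumZ n w : \sum_(1 <= u < n.+1) (Z i u w)%:R - n%:R * mu i =
    c * (\sum_(1 <= u < n.+1) (XF u w)%:R - n%:R * mF) - s i * e n w.
  have -> : \sum_(1 <= u < n.+1) (Z i u w)%:R - n%:R * mu i = - deficit Z mu n w i.
    by rewrite /deficit opprB.
  rewrite /e /imbalance sumD -/(s i) -/ss /c.
  by field; rewrite !gt_eqF.
split.
  have e_cvg : cvg_as P (fun n w => e n.+1 w / n.+1%:R) 0.
    apply: ae_cvg0_inverse_square => [n|eps eps0].
      by apply: measurable_funM => //; exact: me.
    exists (2 * C / eps ^+ 4); split=> [|n].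
      by rewrite divr_ge0 ?mulr_ge0 ?exprn_ge0 ?(ltW eps0).
    have n0 : 0 < n.+1%:R :> R by rewrite ltr0n.
    have n1 : 1 <= n.+1%:R :> R by rewrite ler1n.
    (* The tail bound is of order [n / n ^ 4], which is more than the inverse square required. *)
    have := tail n.+1 i (eps * n.+1%:R) (mulr_gt0 eps0 n0).
    rewrite (_ : [set w | _] = [set w | eps <= `|e n.+1 w / n.+1%:R|]); last first.
      apply/seteqP; split=> w /=;
      by rewrite normrM normfV (gtr0_norm n0) ler_pdivlMr.
    move=> /le_trans; apply; rewrite lee_fin -[n.+2%:R]natr1.
    move: n0 n1; set a := n.+1%:R => a0 a1.
    rewrite -subr_ge0 (_ : _ - _ = C * (2 * a ^+ 2 - a - 1) / (eps ^+ 4 * a ^+ 4)).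
      by rewrite divr_ge0 ?mulr_ge0 ?exprn_ge0 ?(ltW eps0) ?(ltW a0) //; nra.
    by field; rewrite !gt_eqF.
  apply: filterS2 asF e_cvg => w Fw ew.
  rewrite -(cvg_shiftS (fun n => time_average R (Z i) n w)) /=.
  rewrite -(cvg_shiftS (fun n => time_average R XF n w)) /= in Fw.
  have -> : (fun n => time_average R (Z i) n.+1 w) =
      (fun n => mu i + c * (time_average R XF n.+1 w - mF) - s i * (e n.+1 w / n.+1%:R)).
    apply/funext => n; have := sumZ n.+1 w; rewrite /time_average.
    have n0 : n.+1%:R != 0 :> R by rewrite pnatr_eq0.
    set a := n.+1%:R in n0 *; set x := \sum_(1 <= t < _) _; set y := \sum_(1 <= t < _) _.
    move=> H; have -> : x = n.+1%:R * mu i + (c * (y - a * mF) - s i * e n.+1 w).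
      by rewrite -H; ring.
    by field.
  have lim0 : mu i + c * (mF - mF) - s i * 0 = mu i by rewrite subrr !mulr0 addr0 subr0.
  have : (mu i + c * (time_average R XF n.+1 w - mF) - s i * (e n.+1 w / n.+1%:R)
      @[n --> \oo] --> mu i + c * (mF - mF) - s i * 0); last by rewrite lim0.
  apply: cvgB; last by apply: cvgMl_tmp; exact: ew.
  apply: cvgD; first exact: cvg_cst.
  by apply: cvgMl_tmp; apply: cvgB; [exact: Fw|exact: cvg_cst].
exists (scaled_law L c); split; last first.
  rewrite scaled_law_second_moment EL -EFinM lee_fin.
  have sE : s i ^+ 2 = sigma2 i by rewrite sqr_sqrtr // ltW.
  rewrite -sE /c exprMn exprVn mulrAC ler_pdivrMr ?exprn_gt0 // ler_wpM2l ?sqr_ge0 //.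
  (* What is left is [v2 <= ss ^ 2] for the full set; it is the square of the hypothesis on the
     [sigma2 i] when [v2] is nonnegative, and trivial otherwise. *)
  have [v0|v0] := leP 0 (v2 [set: 'I_N]%SET); last by rewrite (le_trans (ltW v0)) ?sqr_ge0.
  by rewrite -[leLHS]sqr_sqrtr // lerXn2r ?nnegrE ?sqrtr_ge0 // ltW.
apply: (slutsky lawF) => [n|eps eps0].
  have -> : scaled_deviation (Z i) (mu i) n = (fun w => - deficit Z mu n w i / Num.sqrt n%:R).
    by apply/funext => w; rewrite /scaled_deviation /deficit opprB.
  by apply: measurable_funM => //; apply: measurableT_comp => //; exact: mdef.
(* At the threshold [eps * sqrt (n + 1) / s i] the tail bound is [C * s i ^ 4 * (n + 2) / (eps ^ 4 *
   (n + 1) ^ 2)], and [n + 2 <= 2 * (n + 1)]. *)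
pose b n : R := 2 * C * s i ^+ 4 / eps ^+ 4 * harmonic n.
have b0 : ((b n)%:E @[n --> \oo] --> 0)%E.
  apply: cvg_EFin; first exact: nearW.
  have : (b n @[n --> \oo] --> 2 * C * s i ^+ 4 / eps ^+ 4 * 0).
    by apply: cvgMl_tmp; exact: cvg_harmonic.
  by rewrite mulr0.
rewrite -cvg_shiftS /=.
apply: (squeeze_cvge _ (cvg_cst 0%E) b0).
apply: nearW => n; apply/andP; split=> //.
have n0 : 0 < n.+1%:R :> R by rewrite ltr0n.
have q0 : 0 < Num.sqrt n.+1%:R :> R by rewrite sqrtr_gt0.
have := tail n.+1 i (eps * Num.sqrt n.+1%:R / s i) (ltac:(by rewrite divr_gt0 // mulr_gt0)).
rewrite (_ : [set w | _] = [set w | eps <= `|scaled_deviation (Z i) (mu i) n.+1 w -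
    c * scaled_deviation XF mF n.+1 w|]); last first.
  have E w : scaled_deviation (Z i) (mu i) n.+1 w - c * scaled_deviation XF mF n.+1 w =
      - (s i * e n.+1 w / Num.sqrt n.+1%:R).
    by rewrite /scaled_deviation sumZ; field; rewrite gt_eqF.
  apply/seteqP; split=> w /=; rewrite E normrN 2!normrM normfV;
  by rewrite (gtr0_norm q0) (gtr0_norm (s0 i)) ler_pdivlMr // ler_pdivrMr // [_ * s i]mulrC.
move=> /le_trans; apply; rewrite lee_fin /b /harmonic /= -[n.+2%:R]natr1.
have q4 : Num.sqrt n.+1%:R ^+ 4 = n.+1%:R ^+ 2 :> R.
  by rewrite -[4%N]/(2 * 2)%N exprM sqr_sqrtr // ltW.
have n1 : 1 <= n.+1%:R :> R by rewrite ler1n.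
rewrite !exprMn exprVn q4; move: n0 n1; set a := n.+1%:R => a0 a1.
rewrite -subr_ge0 (_ : _ - _ = C * s i ^+ 4 * (a - 1) / (eps ^+ 4 * a ^+ 2)).
  by rewrite divr_ge0 ?mulr_ge0 ?exprn_ge0 ?(ltW eps0) ?(ltW a0) ?(ltW (s0 i)) //; lra.
by field; rewrite !gt_eqF.
Qed.
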